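(* Fix $t\in\mathbb{R}$ and let $\alpha_{i,n}$ be the local levels of the one-sided HC test with critical values $h_{i,n}(d_n(t))$. Let $i_n\in\{1,\dots,n\}$ be a sequence of ranks. If $i_n/u_n\to c$ for some $c>0$ and $c_n=u_n/i_n$, then $$\alpha_{i_n,n}=\frac{\sqrt{c_n}}{(1-\delta(c_n))\sqrt{2\pi u_n}}\left[\frac{\delta(c_n)\exp(1)}{\exp(\delta(c_n))}\right]^{u_n/c_n}\left[\frac{\sqrt\pi\exp(-t)}{\sqrt{u_n}}\right]^{(1-\delta(c_n))/\sqrt{c_n^2+2c_n}}[1+o(1)],$$ where $\delta(x)=1+x-\sqrt{x^2+2x}$. If $(n-i_n)/u_n\to c$ for some $c>0$ and $c_n=(n-i_n)/u_n$, then $$\alpha_{i_n,n}=\Bigl(1+\frac{c_n}{1+\sqrt{1+2c_n}}\Bigr)\frac{1}{\sqrt{2\pi c_nu_n}}\Bigl(\frac{1+c_n+\sqrt{1+2c_n}}{c_n}\Bigr)^{c_nu_n}\Bigl(\frac{\sqrt\pi\exp(-t)}{\sqrt{u_n}}\Bigr)^{1+1/\sqrt{1+2c_n}}\log(n)^{-(1+\sqrt{1+2c_n})}\,[1+o(1)].$$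
   Context: Let $u_n=\log(\log(n))$ and, for fixed $t\in\mathbb{R}$, $d_n(t)=\bigl(t+2u_n+(\log(u_n)-\log(\pi))/2\bigr)/\sqrt{2u_n}$ (everything is considered for $n$ large enough to be defined with $d_n(t)\ge1$). For $1\le i\le n$ let $$h_{i,n}(d)=\frac{d^2+2i-d\sqrt{d^2+4i-4i^2/n}}{2(d^2+n)}.$$ The local levels of the one-sided higher criticism (HC) test based on $d_n(t)$ are $\alpha_{i,n}=\mathbb{P}(U_{i:n}<h_{i,n}(d_n(t)))=\mathbb{P}(Z_n\ge i)$, where $U_{i:n}$ is the $i$th order statistic of $n$ i.i.d. uniform random variables on $[0,1]$ and $Z_n$ is binomial with parameters $n$ and $h_{i,n}(d_n(t))$. Asymptotic symbols refer to $n\to\infty$. *)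

(* Defs.v *)
From HB Require Import structures.
From mathcomp Require Import all_boot all_order all_algebra.
From mathcomp Require Import all_classical all_reals all_analysis.

Set Implicit Arguments.
Unset Strict Implicit.
Unset Printing Implicit Defensive.

Import Order.TTheory GRing.Theory Num.Theory.
Import numFieldTopology.Exports numFieldNormedType.Exports.

Local Open Scope classical_set_scope.
Local Open Scope ring_scope.

(* ln, Num.sqrt and / are total: u and d take junk values for small n, which
   the asymptotic statement ignores. *)
Definition u {R : realType} (n : nat) : R := ln (ln n%:R).

Definition d {R : realType} (t : R) (n : nat) : R :=
  (t + 2 * u n + (ln (u n) - ln pi) / 2) / Num.sqrt (2 * u n).

Definition h {R : realType} (i n : nat) (x : R) : R :=
  (x ^+ 2 + 2 * i%:R
     - x * Num.sqrt (x ^+ 2 + 4 * i%:R - 4 * i%:R ^+ 2 / n%:R))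
  / (2 * (x ^+ 2 + n%:R)).

Definition delta {R : realType} (x : R) : R :=
  1 + x - Num.sqrt (x ^+ 2 + 2 * x).

Definition mutually_independent {R : realType} {disp : measure_display}
    {T : measurableType disp} (P : probability T R) {n : nat}
    (X : 'I_n -> {RV P >-> R}) : Prop :=
  forall (J : {set 'I_n}) (A : 'I_n -> set R),
    (forall j, measurable (A j)) ->
    P (\bigcap_(j in [set j | j \in J]) (X j @^-1` A j)) =
    (\prod_(j in J) P (X j @^-1` A j))%E.

Definition iid_uniform01 {R : realType} {disp : measure_display}
    {T : measurableType disp} (P : probability T R) {n : nat}
    (X : 'I_n -> {RV P >-> R}) : Prop :=
  mutually_independent X /\
  forall j (A : set R), measurable A ->
    distribution P (X j) A = uniform_prob (@ltr01 R) A.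

(* Ranks are numbered from 1; meaningful for 1 <= i <= n. *)
Definition order_statistic {R : realType} {n : nat} (x : 'I_n -> R) (i : nat) :
    R :=
  nth 0 (sort <=%R [seq x j | j <- enum 'I_n]) i.-1.

Definition local_level {R : realType} {disp : measure_display}
    {T : measurableType disp} (P : probability T R) {n : nat}
    (X : 'I_n -> {RV P >-> R}) (t : R) (i : nat) : R :=
  fine (P [set w | order_statistic (fun j => X j w) i < h i n (d t n)]).

(* a_n = b_n (1 + o(1)) as n -> oo. *)
Definition eq_1o1 {R : realType} (a b : nat -> R) : Prop :=
  exists2 e : nat -> R, e @ \oo --> (0 : R) &
    \forall n \near \oo, a n = b n * (1 + e n).

(* Main.v *)
Require Import Defs.
From mathcomp Require Import all_boot all_order all_algebra.
From mathcomp Require Import all_classical all_reals all_analysis.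
From mathcomp Require Import ring lra.
Import Order.TTheory GRing.Theory Num.Theory.
Import numFieldTopology.Exports numFieldNormedType.Exports.
Local Open Scope classical_set_scope.
Local Open Scope ring_scope.

(** The local level is a binomial tail P(Z >= i) with success probability
    p = h_{i,n}(d_n), and such a tail is governed by its first term.

    Consecutive binomial weights have slowly varying ratios, so when i and n - i
    both tend to infinity and the ratio r at i stays below 1, the tail is
    equivalent to the weight at i times 1 / (1 - r): it behaves like a geometric
    series ([binom_tail_equiv]).  The weight itself is equivalent to a Poisson
    weight with mean np ([binom_pmf_equiv], by Stirling's formula, proved from the
    Wallis integrals in [stirling]), because i and np are of order
    u = log log n.  When n - i is of order u the same is done with
    successes and failures exchanged: P(Z = i) is the weight at the rank n - i for
    1 - p.

    What remains is the size of exp(k rate(w)), where rate(v) = log v + 1 - v, k is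
    the small rank and w is the mean divided by k.  The number h_{i,n}(d) is a root
    of (np - k)^2 = d^2 np (1 - p) ([h_root]); for w this says
    (w - 1)^2 / (2w) = d^2 (1 - p) / (2k), whose right side is
    u / k + (drift + o(1)) / k since d^2 = 2u + 2 drift + o(1), where
    exp(- drift) = sqrt(pi) e^(-t) / sqrt(u).  Replacing the right side by u / k
    replaces w by v = delta(u/k) if w < 1, and by its inverse if w > 1.  To
    first order the rate changes by the variation of (w - 1)^2 / (2w) times
    - 2v / (1 + v) ([rate_expansion]), and the second order error is negligible
    because drift^2 / u tends to 0.  Hence
    exp(k rate(w)) is equivalent to
    exp(k rate(v)) (sqrt(pi) e^(-t) / sqrt(u))^(2v / (1 + v))
    ([boundary_pmf_equiv]), and both formulas follow by rewriting functions of v in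
    terms of c_n ([small_rank_form], [large_rank_form]). *)

Set Implicit Arguments. Unset Strict Implicit. Unset Printing Implicit Defensive.

(** * Wallis integrals *)

Lemma is_derive_ge0_le (R : realType) (f g : R -> R) (a b : R) :
  (forall x, a <= x <= b -> is_derive x 1 f (g x)) ->
  (forall x, a <= x <= b -> 0 <= g x) -> a <= b -> f a <= f b.
Proof.
move=> fg g0 ab.
have fd x : a <= x <= b -> derivable f x 1.
  by move=> /fg [].
apply: (@ger0_derive1_ndecr R f a b) => //.
- move=> x; rewrite in_itv/= => /andP[ax xb].
  by apply: fd; rewrite !ltW.
- move=> x; rewrite in_itv/= => /andP[ax xb].
  have axb : a <= x <= b by rewrite !ltW.
  by rewrite derive1E (@derive_val _ _ _ _ _ _ _ (fg x axb)) g0.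
- apply: continuous_in_subspaceT => x; rewrite inE/= in_itv/= => axb.
  by apply: differentiable_continuous; apply/derivable1_diffP/fd.
Qed.

(** The difference of the two sides vanishes at 1 and has derivative
    (y - 1)^2 / (y (y + 1)^2).  At y = (n+1)/n the bound is 2 / (2n + 1), which
    is what makes the Stirling sequence below decrease. *)
Lemma ln_ge_pade (R : realType) (y : R) : 1 <= y -> 2 * (y - 1) / (y + 1) <= ln y.
Proof.
move=> y1.
have := @is_derive_ge0_le R (fun y => ln y - 2 * (y - 1) / (y + 1))
   (fun y => (y - 1) ^+ 2 / (y * (y + 1) ^+ 2)) 1 y.
rewrite ln1 subrr mulr0 mul0r subrr subr_ge0; apply => // x /andP[x1 _].
  have x0 : 0 < x by lra.
  have x10 : x + 1 != 0 by lra.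
  have Hln := is_derive1_ln x0.
  have Hid : is_derive x 1 (fun y : R => y + 1) 1.
    by apply: is_derive_eq; rewrite addr0.
  have Hnum : is_derive x 1 (fun y : R => 2 * (y - 1)) 2.
    apply: (is_derive_eq (is_deriveM (is_derive_cst (2 : R) x 1)
      (is_deriveB (is_derive_id x 1) (is_derive_cst (1 : R) x 1)))).
    by rewrite /GRing.scale /= !fctE; ring.
  have Hinv := @is_deriveV R (fun y => y + 1) x _ _ x10 Hid.
  apply: (is_derive_eq (is_deriveB Hln (is_deriveM Hnum Hinv))).
  rewrite /GRing.scale /=; field.
  by rewrite x10 gt_eqF.
by apply: divr_ge0; [apply: sqr_ge0|apply: mulr_ge0; [lra|apply: sqr_ge0]].
Qed.

(** The trapezoidal rule overestimates the integral of the convex function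
    1/x over [1, y]. *)
Lemma ln_le_trapezoid (R : realType) (y : R) : 1 <= y -> ln y <= (y - y^-1) / 2.
Proof.
move=> y1.
have := @is_derive_ge0_le R (fun y => (y - y^-1) / 2 - ln y)
   (fun y => (1 - y^-1) ^+ 2 / 2) 1 y.
rewrite ln1 invr1 subrr mul0r subrr subr_ge0; apply => // x /andP[x1 _].
  have x0 : 0 < x by lra.
  have x10 : x != 0 by lra.
  have Hln := is_derive1_ln x0.
  have Hinv := @is_deriveV R id x _ _ x10 (is_derive_id x 1).
  have H2 := is_deriveM (is_deriveB (is_derive_id x 1) Hinv) (is_derive_cst (2^-1 : R) x 1).
  apply: (is_derive_eq (is_deriveB H2 Hln)).
  by rewrite /GRing.scale /=; field.
by rewrite divr_ge0 ?sqr_ge0.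
Qed.

(** The primitive of [cos ^+ n] vanishing at 0, by the reduction formula for
    cos^(n+2).  Having the primitive in closed form replaces integration: the
    Wallis integrals are values of it, and comparing two of them amounts to
    comparing two derivatives. *)
Fixpoint cos_prim (R : realType) (n : nat) (x : R) : R :=
  match n with
  | 0 => x
  | 1 => sin x
  | m.+2 => (sin x * cos x ^+ m.+1 + m.+1%:R * cos_prim m x) / m.+2%:R
  end.

Lemma nat_ind_by2 (Q : nat -> Prop) : Q 0 -> Q 1 -> (forall n, Q n -> Q n.+2) -> forall n, Q n.
Proof.
move=> Q0 Q1 QS n; suff : Q n /\ Q n.+1 by case.
by elim: n => [//|n [Qn QSn]]; split=> //; exact: QS.
Qed.

Lemma cos_prim0 (R : realType) n : cos_prim n (0 : R) = 0.
Proof.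
elim/nat_ind_by2: n => [||n IH] //=; first exact: sin0.
by rewrite IH sin0 mul0r mulr0 addr0 mul0r.
Qed.

Lemma is_derive_cos_prim (R : realType) n (x : R) :
  is_derive x 1 (cos_prim n) (cos x ^+ n).
Proof.
elim/nat_ind_by2: n => [||n IH].
- by rewrite expr0; exact: is_derive_id.
- by rewrite expr1; exact: is_derive_sin.
- have E : cos ^+ n.+1 = (fun y : R => cos y ^+ n.+1) by rewrite exprfctE.
  have H1 := is_deriveM (is_derive_sin x) (is_deriveX n.+1 (is_derive_cos x)).
  rewrite E in H1.
  have H2 := is_deriveM (is_derive_cst (n.+1%:R : R) x 1) IH.
  have H3 := is_deriveM (is_deriveD H1 H2) (is_derive_cst (n.+2%:R^-1 : R) x 1).
  apply: (is_derive_eq H3).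
  rewrite /GRing.scale /=.
  have -> : sin x * (n.+1%:R * cos x ^+ n * - sin x) =
     - (n.+1%:R * cos x ^+ n * sin x ^+ 2) by ring.
  rewrite sin2cos2 !fctE !mulr0 addr0 add0r -[n.+2%:R]natr1 !(exprS _ n.+1) !(exprS _ n) expr2.
  field.
  by rewrite gt_eqF//; have := ler0n R n; lra.
Qed.

(** The integral of [cos ^+ n] over [0, pi/2]. *)
Definition wallis (R : realType) (n : nat) : R := cos_prim n (pi / 2).

Lemma wallis0 (R : realType) : wallis R 0 = pi / 2. Proof. by []. Qed.

Lemma wallis1 (R : realType) : wallis R 1 = 1. Proof. exact: sin_pihalf. Qed.

Lemma wallisSS (R : realType) n :
  wallis R n.+2 = n.+1%:R / n.+2%:R * wallis R n.
Proof.
by rewrite /wallis /= cos_pihalf exprS mul0r mulr0 add0r mulrAC.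
Qed.

Lemma wallis_gt0 (R : realType) n : 0 < wallis R n.
Proof.
elim/nat_ind_by2: n => [||n IH].
- by rewrite wallis0 divr_gt0 ?pi_gt0.
- by rewrite wallis1.
- by rewrite wallisSS mulr_gt0// divr_gt0.
Qed.

Lemma wallisS_le (R : realType) n : wallis R n.+1 <= wallis R n.
Proof.
rewrite -subr_ge0 /wallis.
have := @is_derive_ge0_le R (fun x => cos_prim n x - cos_prim n.+1 x)
  (fun x => cos x ^+ n - cos x ^+ n.+1) 0 (pi / 2).
rewrite !cos_prim0 subrr; apply.
- by move=> x _; exact: is_deriveB (is_derive_cos_prim n x) (is_derive_cos_prim n.+1 x).
- move=> x /andP[x0 x2].
  have c0 : 0 <= cos x.
    by apply: cos_ge0_pihalf; rewrite x2 andbT (le_trans _ x0)// oppr_le0 divr_ge0 ?pi_ge0.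
  by rewrite subr_ge0 exprS ler_piMl ?cos_le1 ?exprn_ge0.
- by rewrite divr_ge0 ?pi_ge0.
Qed.

(** The recurrence makes n W(n-1) W(n) independent of n. *)
Lemma wallis_mulS (R : realType) n :
  n.+1%:R * (wallis R n * wallis R n.+1) = pi / 2.
Proof.
elim: n => [|n IH]; first by rewrite wallis0 wallis1 mul1r mulr1.
rewrite -IH wallisSS; field.
by rewrite !gt_eqF//; have := ler0n R n; lra.
Qed.

Lemma wallis_bin (R : realType) n :
  wallis R n.*2 = 'C(n.*2, n)%:R / 4 ^+ n * (pi / 2).
Proof.
elim: n => [|n IH]; first by rewrite bin0 expr0 divr1 mul1r.
rewrite doubleS wallisSS IH.
have : ('C(n.*2.+2, n.+1) * (n.+1)  = 'C(n.*2, n) * (n.*2.+1) * 2)%N.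
  rewrite mulnC -mul_bin_diag /= -doubleS -mul2n -mulnA mulnC; congr muln.
  have := mul_bin_down n.*2.+1 n; rewrite /= subSn -addnn ?leq_addr// addnK => <-.
  by rewrite mulnC.
move/(congr1 (fun m => m%:R : R)); rewrite !natrM => E.
have -> : 'C(n.*2.+2, n.+1)%:R = 'C(n.*2, n)%:R * n.*2.+1%:R * 2 / n.+1%:R :> R.
  by rewrite -E mulfK// pnatr_eq0.
rewrite exprS -addnn -[(n+n).+2%:R]natr1 -[(n+n).+1%:R]natr1 natrD; field.
by rewrite !gt_eqF ?exprn_gt0//; have := ler0n R n; lra.
Qed.

(** * Stirling's formula *)

Lemma cvg_near_eq (R : realType) T (F : set_system T) {FF : Filter F} (f g : T -> R) (l : R) :
  (\forall x \near F, f x = g x) -> g @ F --> l -> f @ F --> l.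
Proof.
move=> fg; apply: cvg_trans; apply: near_eq_cvg.
by apply: filterS fg => x ->.
Qed.

Lemma cvg_expR (R : realType) T (F : set_system T) {FF : Filter F} (f : T -> R) (l : R) :
  f @ F --> l -> expR (f x) @[x --> F] --> expR l.
Proof. by move=> fl; apply: continuous_cvg fl; exact: continuous_expR. Qed.

Lemma cvg_sqrt (R : realType) T (F : set_system T) {FF : Filter F} (f : T -> R) (l : R) :
  f @ F --> l -> Num.sqrt (f x) @[x --> F] --> Num.sqrt l.
Proof. by move=> fl; apply: continuous_cvg fl; exact: sqrt_continuous. Qed.

Section Stirling.
Variable R : realType.
Implicit Types n : nat.

(** As W is nonincreasing, n W(n)^2 lies between n / (n + 1) times and 1 times
    the constant value pi/2 of n W(n-1) W(n); and W(2n) is pi/2 times the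
    probability of n heads in 2n fair tosses. *)
Lemma cvg_central_bin :
  (n%:R * pi * ('C(n.*2, n)%:R / 4 ^+ n) ^+ 2 : R) @[n --> \oo] --> (1 : R).
Proof.
apply: (@squeeze_cvgr _ _ _ _ (fun n => 1 - (n.+1%:R : R)^-1) (cst 1)); last 2 first.
- rewrite -[X in _ --> X]subr0; apply: cvgB; first exact: cvg_cst.
  exact: cvg_harmonic.
- exact: cvg_cst.
near=> n.
have n0 : (0 < n)%N by near: n; exact: nbhs_infty_gt.
have pi0 := pi_gt0 R.
set b := _ / _.
have bE : wallis R n.*2 = b * (pi / 2) by rewrite wallis_bin.
have w0 := wallis_gt0 R n.*2.
have nE : n.*2%:R = n%:R * 2 :> R by rewrite -muln2 natrM.
have up : n%:R * 2 * wallis R n.*2 ^+ 2 <= pi / 2.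
  have [m mE] : exists m, n.*2 = m.+1 by exists n.*2.-1; rewrite prednK// double_gt0.
  rewrite -nE mE -(wallis_mulS R m) expr2 ler_pM2l// ler_pM2r -?mE//.
  by rewrite mE wallisS_le.
have lo : pi / 2 <= (n%:R * 2 + 1) * wallis R n.*2 ^+ 2.
  rewrite -(wallis_mulS R n.*2) -natr1 nE expr2 ler_pM2l; last by rewrite ltr_wpDl// mulr_ge0.
  by rewrite ler_pM2l// wallisS_le.
have -> : n%:R * pi * b ^+ 2 = (n%:R * 2 * wallis R n.*2 ^+ 2) / (pi / 2).
  by rewrite bE; move: (pi : R) pi0 => P P0; field; rewrite gt_eqF.
rewrite /=; apply/andP; split; last by rewrite ler_pdivrMr ?mul1r ?divr_gt0.
rewrite ler_pdivlMr ?divr_gt0//.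
apply: le_trans (ler_wpM2l _ lo) _.
  by rewrite subr_ge0 invf_le1// ler1n.
rewrite mulrA ler_pM2r ?exprn_gt0// -natr1.
rewrite -subr_ge0.
have n1 : 1 <= n%:R :> R by rewrite ler1n.
have -> : n%:R * 2 - (1 - (n%:R + 1)^-1) * (n%:R * 2 + 1) = n%:R / (n%:R + 1) :> R.
  by field; rewrite gt_eqF//; lra.
by rewrite divr_ge0//; lra.
Unshelve. all: by end_near. Qed.

Definition ln_stirling n : R := ln (n`!%:R) - (n%:R + 2^-1) * ln n%:R + n%:R.

Lemma ln_stirlingB n : (0 < n)%N -> ln_stirling n - ln_stirling n.+1 =
  (n%:R + 2^-1) * ln (n.+1%:R / n%:R) - 1.
Proof.
move=> n0; have n0R : 0 < n%:R :> R by rewrite ltr0n.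
rewrite /ln_stirling factS natrM lnM ?posrE ?ltr0n ?fact_gt0//.
rewrite ln_div ?posrE// -natr1; ring.
Qed.

(** This and the next lemma squeeze the sequence: it decreases, while it
    increases once 1/(4n) is subtracted. *)
Lemma ln_stirlingS_le n : (0 < n)%N -> ln_stirling n.+1 <= ln_stirling n.
Proof.
move=> n0; have n0R : 0 < n%:R :> R by rewrite ltr0n.
have y1 : 1 <= n.+1%:R / n%:R :> R by rewrite ler_pdivlMr// mul1r ler_nat.
rewrite -subr_ge0 ln_stirlingB// subr_ge0.
apply: le_trans (ler_wpM2l _ (ln_ge_pade y1)); last by rewrite addr_ge0// ltW.
rewrite le_eqVlt; apply/orP; left; apply/eqP.
by rewrite -natr1; field; rewrite !gt_eqF//; lra.
Qed.

Lemma ln_stirling_corrected_ge n : (0 < n)%N ->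
  ln_stirling n - (4 * n%:R)^-1 <= ln_stirling n.+1 - (4 * n.+1%:R)^-1.
Proof.
move=> n0; have n0R : 0 < n%:R :> R by rewrite ltr0n.
have y1 : 1 <= n.+1%:R / n%:R :> R by rewrite ler_pdivlMr// mul1r ler_nat.
suff : ln_stirling n - ln_stirling n.+1 <= (4 * n%:R)^-1 - (4 * n.+1%:R)^-1.
  by move: (_ ^-1) (_ ^-1) => x y; lra.
rewrite ln_stirlingB// lerBlDr.
apply: le_trans (ler_wpM2l _ (ln_le_trapezoid y1)) _; first by rewrite addr_ge0// ltW.
rewrite le_eqVlt; apply/orP; left; apply/eqP.
by rewrite -natr1; field; rewrite !gt_eqF//; lra.
Qed.

Lemma is_cvg_ln_stirling : cvgn ln_stirling.
Proof.
apply/cvg_ex; suff : cvgn (fun n => ln_stirling n.+1).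
  by move=> /cvg_ex[s Hs]; exists s; rewrite -(cvg_shiftS ln_stirling).
apply: nonincreasing_is_cvgn.
  by apply/nonincreasing_seqP => n; exact: ln_stirlingS_le.
exists (ln_stirling 1 - 4^-1) => _ [n _ <-].
suff : ln_stirling 1 - 4^-1 <= ln_stirling n.+1 - (4 * n.+1%:R)^-1.
  by move=> /le_trans; apply; rewrite gerBl invr_ge0 mulr_ge0.
elim: n => [|n IH]; first by rewrite mulr1.
by rewrite (le_trans IH)// ln_stirling_corrected_ge.
Qed.

Lemma expR_ln_stirling n : (0 < n)%N ->
  expR (ln_stirling n) = n`!%:R / (Num.sqrt n%:R * (n%:R / expR 1) ^+ n).
Proof.
move=> n0; have n0R : 0 < n%:R :> R by rewrite ltr0n.
rewrite /ln_stirling expRD expRB lnK ?posrE ?ltr0n ?fact_gt0//.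
rewrite mulrDl expRD expRM_natl lnK ?posrE// mulrC -powR12_sqrt; last exact: ltW.
rewrite /powR gt_eqF// expr_div_n.
have -> : expR n%:R = expR 1 ^+ n :> R by rewrite -expRM_natl mulr1.
by field; rewrite !gt_eqF ?exprn_gt0 ?expR_gt0.
Qed.

(** The limit s exists by monotonicity.  The combination S(2n) - 2 S(n) tends to
    - s on one side, and on the other it is the logarithm of sqrt(n/2) times the
    central binomial probability, whose limit is known from the Wallis
    integrals. *)
Lemma cvg_ln_stirling : ln_stirling n @[n --> \oo] --> ln (Num.sqrt (2 * pi) : R).
Proof.
have /cvg_ex[/= s Hs] := is_cvg_ln_stirling.
have pi0 := pi_gt0 R.
have Hd : (ln_stirling n.*2 @[n --> \oo] --> s).
  apply: (@cvg_comp _ _ _ double ln_stirling _ \oo) Hs.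
  by apply/cvgnyPge => A; near=> n; rewrite -addnn (leq_trans _ (leq_addr _ _))//;
     near: n; exact: nbhs_infty_ge.
have H1 : (expR (2 * (ln_stirling n.*2 - ln_stirling n - ln_stirling n))
     @[n --> \oo] --> expR (2 * (s - s - s))).
  apply: cvg_expR.
  by apply: cvgMr; apply: cvgB => //; apply: cvgB.
have H2 : (expR (2 * (ln_stirling n.*2 - ln_stirling n - ln_stirling n))
     @[n --> \oo] --> (2 * pi)^-1 * 1).
  apply: (cvg_near_eq _ (cvgM (cvg_cst _) cvg_central_bin)).
  near=> n; rewrite /=.
  have n0 : (0 < n)%N by near: n; exact: nbhs_infty_gt.
  have n0R : 0 < n%:R :> R by rewrite ltr0n.
  rewrite expRM_natl !expRB !expR_ln_stirling ?double_gt0//.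
  have e0 := expR_gt0 (1 : R).
  have -> : 'C(n.*2, n)%:R = (n.*2)`!%:R / (n`!%:R * n`!%:R) :> R.
    have := @bin_fact n.*2 n; rewrite -addnn leq_addr addnK => /(_ isT) <-.
    rewrite natrM natrM mulfK// mulf_neq0// pnatr_eq0 -lt0n fact_gt0//.
  have s2 : Num.sqrt n.*2%:R ^+ 2 = 2 * n%:R :> R.
    by rewrite sqr_sqrtr// -mul2n natrM.
  have s1 : Num.sqrt n%:R ^+ 2 = n%:R :> R by rewrite sqr_sqrtr.
  have f0 : n`!%:R != 0 :> R by rewrite pnatr_eq0 -lt0n fact_gt0.
  have s20 : Num.sqrt n.*2%:R != 0 :> R.
    by rewrite gt_eqF// sqrtr_gt0 ltr0n double_gt0.
  have s10 : Num.sqrt n%:R != 0 :> R by rewrite gt_eqF// sqrtr_gt0.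
  have -> : (n.*2%:R / expR 1) ^+ n.*2 = 4 ^+ n * ((n%:R / expR 1) ^+ n) ^+ 2 :> R.
    rewrite -mul2n exprM natrM -(exprM _ n 2) (mulnC n 2) exprM -exprMn.
    by congr (_ ^+ _); field; rewrite gt_eqF.
  have A0 : (n%:R / expR 1) ^+ n != 0 :> R.
    by rewrite gt_eqF// exprn_gt0// divr_gt0.
  have P0 : 4 ^+ n != 0 :> R by rewrite gt_eqF// exprn_gt0.
  move: s2 s1 f0 s20 s10 A0 P0 n0R pi0.
  move: (n%:R : R) (n`!%:R : R) ((n.*2)`!%:R : R) (Num.sqrt n%:R) (Num.sqrt n.*2%:R)
    (pi : R) (4 ^+ n) ((n%:R / expR 1) ^+ n)
    => N F G S1 S2 p P A S2E S1E F0 S20 S10 A0 P0 N0 p0.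
  transitivity (G ^+ 2 * (S1 ^+ 2) ^+ 2 / (S2 ^+ 2 * P ^+ 2 * F ^+ 4)).
    by field; rewrite F0 S20 S10 A0 P0.
  by rewrite S1E S2E; field; rewrite F0 P0 !gt_eqF.
rewrite mulr1 in H2.
have E := cvg_unique _ H1 H2.
have -> : ln (Num.sqrt (2 * pi)) = s.
  apply: expR_inj; rewrite lnK ?posrE ?sqrtr_gt0 ?mulr_gt0//.
  apply: (@pexpIrn _ 2); rewrite ?nnegrE ?sqrtr_ge0 ?expR_ge0//.
  rewrite sqr_sqrtr ?mulr_ge0 ?ltW// -expRM_natl.
  apply: invr_inj; rewrite -E // -expRN; congr expR; ring.
by [].
Unshelve. all: by end_near. Qed.

Lemma stirling : (n`!%:R / (Num.sqrt (2 * pi * n%:R) * (n%:R / expR 1) ^+ n) : R)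
  @[n --> \oo] --> (1 : R).
Proof.
have pi0 := pi_gt0 R.
have s0 : 0 < Num.sqrt (2 * pi) :> R by rewrite sqrtr_gt0 mulr_gt0.
have H : (expR (ln_stirling n) * (Num.sqrt (2 * pi))^-1 @[n --> \oo] --> (1 : R)).
  rewrite -[X in _ --> X](divff (lt0r_neq0 s0)).
  apply: cvgM; last exact: cvg_cst.
  by rewrite -[X in _ --> X]lnK ?posrE//; exact: cvg_expR cvg_ln_stirling.
apply: (cvg_near_eq _ H); near=> n.
have n0 : (0 < n)%N by near: n; exact: nbhs_infty_gt.
rewrite expR_ln_stirling// sqrtrM ?mulr_ge0 ?ltW//.
have sn0 : 0 < Num.sqrt n%:R :> R by rewrite sqrtr_gt0 ltr0n.
have A0 : (n%:R / expR 1) ^+ n != 0 :> R.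
  by rewrite gt_eqF// exprn_gt0// divr_gt0 ?expR_gt0// ltr0n.
move: (Num.sqrt n%:R) (Num.sqrt (2 * pi)) (_ ^+ n) sn0 s0 A0 => a b A a0 b0 A0.
by field; rewrite A0 !gt_eqF.
Unshelve. all: by end_near. Qed.
End Stirling.

(** * Binomial tails as geometric series *)

Lemma cvg_natV (R : realType) (k : nat -> nat) :
  k @ \oo --> \oo -> ((k n)%:R^-1 : R) @[n --> \oo] --> (0 : R).
Proof.
move=> ky; apply/(@gtr0_cvgV0 R _ \oo _ (fun n => (k n)%:R)).
  by move/cvgnyPgt : ky => /(_ 0%N); apply: filterS => n; rewrite ltr0n.
by apply/cvgrnyP.
Qed.

Section BinomialTail.
Variable R : realType.
Implicit Types (n k j : nat) (p : R).

Definition binom_pmf n p j : R := 'C(n, j)%:R * p ^+ j * (1 - p) ^+ (n - j).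

Definition binom_tail n p k : R := \sum_(k <= j < n.+1) binom_pmf n p j.

Definition binom_ratio n p j : R := (n - j)%:R * p / (j.+1%:R * (1 - p)).

Lemma binom_pmfS n p j : p < 1 ->
  binom_pmf n p j.+1 = binom_ratio n p j * binom_pmf n p j.
Proof.
move=> p1; rewrite /binom_pmf /binom_ratio.
have [nj|jn] := leqP n j.
  by rewrite bin_small ?ltnS// (eqP (_ : n - j == 0)%N) ?subn_eq0// !mul0r.
have -> : 'C(n, j.+1)%:R = (n - j)%:R * 'C(n, j)%:R / j.+1%:R :> R.
  by rewrite -natrM -mul_bin_left natrM mulrC mulKf// pnatr_eq0.
have -> : (1 - p) ^+ (n - j) = (1 - p) * (1 - p) ^+ (n - j.+1) by rewrite -exprS subnSK.
have q0 : 1 - p != 0 by rewrite gt_eqF// subr_gt0.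
rewrite exprS; move: (_ ^+ (n - _)) (p ^+ j) => A B.
by field; rewrite q0 gt_eqF//; have := ler0n R j; lra.
Qed.

Lemma binom_pmf_gt0 n p j : 0 < p < 1 -> (j <= n)%N -> 0 < binom_pmf n p j.
Proof.
move=> /andP[p0 p1] jn.
by rewrite /binom_pmf !mulr_gt0 ?exprn_gt0 ?subr_gt0// ltr0n bin_gt0.
Qed.

Lemma binom_pmf_ge0 n p j : 0 <= p <= 1 -> 0 <= binom_pmf n p j.
Proof.
by move=> /andP[p0 p1]; rewrite /binom_pmf !mulr_ge0 ?exprn_ge0 ?subr_ge0.
Qed.

Lemma binom_ratio_ge0 n p j : 0 < p < 1 -> 0 <= binom_ratio n p j.
Proof.
move=> /andP[p0 p1].
by rewrite /binom_ratio divr_ge0 ?mulr_ge0// ?ltW// subr_gt0.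
Qed.

Lemma binom_ratio_le n p k j : 0 < p < 1 -> (k <= j)%N ->
  binom_ratio n p j <= binom_ratio n p k.
Proof.
move=> /andP[p0 p1] kj; have q0 : 0 < 1 - p by rewrite subr_gt0.
have [p0' q0'] := (ltW p0, ltW q0).
rewrite /binom_ratio ler_pM ?mulr_ge0 ?invr_ge0 ?mulr_ge0//.
  by rewrite ler_pM2r// ler_nat leq_sub2l.
by rewrite lef_pV2 ?posrE ?mulr_gt0// ler_pM2r// ler_nat ltnS.
Qed.

(** The ratios vary slowly: near rank k they lose a fraction of order
    1/(n-k) + 1/k per step, which vanishes as soon as k and n - k both grow. *)
Lemma binom_ratioB_le n p k j : 0 < p < 1 -> (k < n)%N -> (k <= j < n)%N ->
  binom_ratio n p j - binom_ratio n p j.+1 <=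
  binom_ratio n p k * ((n - k)%:R^-1 + k.+2%:R^-1).
Proof.
move=> /andP[p0 p1] kn /andP[kj jn]; have q0 : 0 < 1 - p by rewrite subr_gt0.
have -> : binom_ratio n p j - binom_ratio n p j.+1 =
   p / (1 - p) * (n.+1%:R / (j.+1%:R * j.+2%:R)).
  rewrite /binom_ratio !natrB// ?(ltnW jn)// -!natr1; field.
  by rewrite !gt_eqF//; have := ler0n R j; lra.
have -> : binom_ratio n p k * ((n - k)%:R^-1 + k.+2%:R^-1) =
   p / (1 - p) * (n.+2%:R / (k.+1%:R * k.+2%:R)).
  have nk0 : 0 < n%:R - k%:R :> R by rewrite subr_gt0 ltr_nat.
  rewrite /binom_ratio !natrB ?(ltnW kn)// -!natr1; field.
  by rewrite !gt_eqF//; have := ler0n R k; lra.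
rewrite ler_pM2l ?divr_gt0// ler_pM ?invr_ge0 ?mulr_ge0 ?ler_nat//.
by rewrite lef_pV2 ?posrE ?mulr_gt0// ler_pM// ler_nat !ltnS.
Qed.

(** Domination by the geometric series of ratio [binom_ratio n p k]. *)
Lemma binom_tail_le n p k : 0 < p < 1 -> (k <= n)%N -> binom_ratio n p k < 1 ->
  binom_tail n p k <= binom_pmf n p k / (1 - binom_ratio n p k).
Proof.
move=> p01 kn r1; have /andP[p0 p1] := p01.
rewrite ler_pdivlMr ?subr_gt0// /binom_tail mulr_suml.
apply: (@le_trans _ _ (\sum_(k <= j < n.+1) (binom_pmf n p j - binom_pmf n p j.+1))).
  apply: ler_sum_nat => j /andP[kj jn]; rewrite binom_pmfS// mulrBr mulr1.
  rewrite lerB// mulrC ler_wpM2l ?binom_ratio_le// binom_pmf_ge0//.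
  by rewrite !ltW.
under eq_bigr do rewrite -opprB.
rewrite sumrN telescope_sumr ?(leqW kn)// opprB lerBlDr lerDl.
by rewrite binom_pmf_ge0// !ltW.
Qed.

(** The geometric sum of ratio r_j started at rank j, g_j = b_j / (1 - r_j),
    telescopes: g_j - g_(j+1) exceeds b_j only through the variation r_j - r_(j+1)
    of the ratio, so it is at most (1 + eta) b_j.  Summing from k gives a lower
    bound of the tail by g_k / (1 + eta). *)
Lemma binom_tail_ge n p k : 0 < p < 1 -> (k < n)%N -> binom_ratio n p k < 1 ->
  let r := binom_ratio n p k in
  binom_pmf n p k / (1 - r) <=
    (1 + r ^+ 2 * ((n - k)%:R^-1 + k.+2%:R^-1) / (1 - r) ^+ 2) * binom_tail n p k.
Proof.
move=> p01 kn r1; cbv zeta; set r := binom_ratio n p k; have /andP[p0 p1] := (p01).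
set eta := _ ^+ 2 * _ / _.
pose g j := binom_pmf n p j / (1 - binom_ratio n p j).
have gn1 : g n.+1 = 0 by rewrite /g /binom_pmf bin_small// !mul0r.
have -> : binom_pmf n p k / (1 - r) = \sum_(k <= j < n.+1) - (g j.+1 - g j).
  by rewrite sumrN telescope_sumr ?gn1 ?sub0r ?opprK// leqW// ltnW.
rewrite /binom_tail mulr_sumr.
apply: ler_sum_nat => j /andP[kj jn]; rewrite opprB /g binom_pmfS//.
set a := binom_ratio n p j; set a' := binom_ratio n p j.+1.
have ar : a <= r by exact: binom_ratio_le.
have aa : a' <= a by exact: binom_ratio_le.
have a'0 : 0 <= a' by exact: binom_ratio_ge0.
have a0 : 0 <= a by exact: binom_ratio_ge0.
have rlt1 : r < 1 by []; have b0 : 0 <= binom_pmf n p j by rewrite binom_pmf_ge0// !ltW.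
have -> : binom_pmf n p j / (1 - a) - a * binom_pmf n p j / (1 - a') =
  (1 + a * (a - a') / ((1 - a) * (1 - a'))) * binom_pmf n p j.
  by field; rewrite !gt_eqF//; lra.
rewrite ler_wpM2r//.
rewrite lerD2l /eta ler_pM//.
- by rewrite mulr_ge0// subr_ge0.
- by rewrite invr_ge0 mulr_ge0// subr_ge0; lra.
- have [jn'|nj] := ltnP j n.
    rewrite expr2 -mulrA ler_pM ?subr_ge0//.
    by apply: binom_ratioB_le => //; rewrite kj.
  have -> : a = 0 by rewrite /a /binom_ratio (eqP (_ : n - j == 0)%N) ?subn_eq0// !mul0r.
  by rewrite mul0r mulr_ge0 ?sqr_ge0// addr_ge0.
- rewrite lef_pV2 ?posrE ?exprn_gt0 ?mulr_gt0// ?subr_gt0//; [| lra..].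
  by rewrite expr2 ler_pM// ?subr_ge0 ?lerB//; lra.
Qed.

(** A binomial tail is equivalent to the geometric series started at its first
    term.  The ranks may be close to either end of 0..n, so the lemma serves the
    smallest as well as the largest order statistics. *)
Lemma binom_tail_equiv (k : nat -> nat) (p : nat -> R) (rho : R) :
  (\forall n \near \oo, 0 < p n < 1) -> (\forall n \near \oo, (k n < n)%N) ->
  k @ \oo --> \oo -> (n - k n)%N @[n --> \oo] --> \oo ->
  binom_ratio n (p n) (k n) @[n --> \oo] --> rho -> rho < 1 ->
  binom_tail n (p n) (k n) / binom_pmf n (p n) (k n) @[n --> \oo] --> (1 - rho)^-1.
Proof.
move=> p01 kn k0 nk0 Hr rho1.
pose r n := binom_ratio n (p n) (k n).
pose eta n := r n ^+ 2 * ((n - k n)%:R^-1 + (k n).+2%:R^-1) / (1 - r n) ^+ 2.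
have Hinv : (1 - r n)^-1 @[n --> \oo] --> (1 - rho)^-1.
  apply: cvgV; first by rewrite subr_eq0 gt_eqF.
  by apply: cvgB => //; exact: cvg_cst.
have Hk2 : ((k n).+2%:R^-1 : R) @[n --> \oo] --> (0 : R).
  apply: (@cvg_natV R (fun n => (k n).+2)).
  apply/cvgnyPge => A; move/cvgnyPge : k0 => /(_ A); apply: filterS => n An.
  by rewrite ltnW// ltnW.
have Hnk := @cvg_natV R _ nk0.
have Heta : eta n @[n --> \oo] --> rho ^+ 2 * (0 + 0) / (1 - rho) ^+ 2.
  rewrite -exprVn; under eq_fun do rewrite /eta -exprVn.
  by apply: cvgM; [apply: cvgM; [exact: cvgM|exact: cvgD]|exact: cvgM].
rewrite addr0 mulr0 mul0r in Heta.
apply: (@squeeze_cvgr _ _ _ _ (fun n => (1 + eta n)^-1 * (1 - r n)^-1) 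
   (fun n => (1 - r n)^-1)) => //.
  near=> n.
  have pn : 0 < p n < 1 by near: n.
  have kn' : (k n < n)%N by near: n.
  have rn : r n < 1 by near: n; exact: cvgr_lt Hr _ rho1.
  have b0 : 0 < binom_pmf n (p n) (k n) by rewrite binom_pmf_gt0// ltnW.
  have e0 : 0 <= eta n.
    apply: divr_ge0; last exact: sqr_ge0.
    by apply: mulr_ge0; [exact: sqr_ge0|rewrite addr_ge0].
  apply/andP; split; last first.
    by rewrite ler_pdivrMr// mulrC binom_tail_le// ltnW.
  have := binom_tail_ge pn kn' rn; rewrite /= -/(r n) -/(eta n) => H.
  rewrite ler_pdivlMr// -mulrA mulrC ler_pdivrMr ?ltr_wpDr// mulrC.
  by rewrite [leRHS]mulrC.
have -> : (1 - rho)^-1 = (1 + 0)^-1 * (1 - rho)^-1 by rewrite addr0 invr1 mul1r.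
apply: cvgM => //; apply: cvgV; first by rewrite addr0 oner_eq0.
by apply: cvgD => //; exact: cvg_cst.
Unshelve. all: by end_near. Qed.
End BinomialTail.

(** * Poisson approximation of binomial weights *)

Section PmfEquiv.
Variable R : realType.
Implicit Types (n k : nat) (p : R).

(** expR (k * rate (l / k)) is e^(-l) (e l / k)^k, the Poisson weight of mean l at
    k up to Stirling's factor. *)
Definition rate (v : R) : R := ln v + 1 - v.

Lemma ffact_ratio_bounds n k : (0 < n)%N ->
  1 - k%:R ^+ 2 / n%:R <= (n ^_ k)%:R / n%:R ^+ k :> R /\ (n ^_ k)%:R / n%:R ^+ k <= 1 :> R.
Proof.
move=> n0; have nR : 0 < n%:R :> R by rewrite ltr0n.
elim: k => [|k [lo up]]; first by rewrite expr0n mul0r subr0 ffactn0 expr0 divr1 lexx.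
have -> : (n ^_ k.+1)%:R / n%:R ^+ k.+1 =
  ((n ^_ k)%:R / n%:R ^+ k * ((n - k)%:R / n%:R) : R).
  by rewrite ffactnSr natrM exprSr invfM; ring.
set A := (n ^_ k)%:R / n%:R ^+ k in lo up *; set B := (n - k)%:R / n%:R.
have A0 : 0 <= A by rewrite divr_ge0 ?exprn_ge0.
have B0 : 0 <= B by rewrite divr_ge0.
have B1 : B <= 1 by rewrite ler_pdivrMr// mul1r ler_nat leq_subr.
have Bl : 1 - k%:R / n%:R <= B.
  rewrite /B -[X in X - _](divff (lt0r_neq0 nR)) -mulrBl ler_pM2r ?invr_gt0//.
  have [kn|nk] := leqP k n; first by rewrite natrB.
  by rewrite (le_trans _ (ler0n _ _))// subr_le0 ler_nat ltnW.
split; last by rewrite mulr_ile1.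
have AB : A + B - 1 <= A * B by nra.
apply: le_trans AB.
suff : k%:R ^+ 2 / n%:R + k%:R / n%:R <= k.+1%:R ^+ 2 / n%:R :> R by lra.
by rewrite -mulrDl ler_pM2r ?invr_gt0// -natr1; have := ler0n R k; nra.
Qed.

Lemma onem_expn_bounds n k p : (k <= n)%N -> 0 < p < 1 ->
  expR (- (n%:R * p ^+ 2 / (1 - p))) <= (1 - p) ^+ (n - k) * expR (n%:R * p)
    <= expR (k%:R * p).
Proof.
move=> kn /andP[p0 p1]; have q0 : 0 < 1 - p by rewrite subr_gt0.
have nk : (n - k)%:R = n%:R - k%:R :> R by rewrite natrB.
apply/andP; split.
  have H : expR (- (p / (1 - p))) <= 1 - p.
    rewrite expRN invf_ple ?posrE ?expR_gt0//.
    apply: le_trans (expR_ge1Dx _); rewrite le_eqVlt; apply/orP; left; apply/eqP.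
    by field; rewrite gt_eqF.
  have := lerXn2r (n - k)%N (expR_ge0 _) (ltW q0) H.
  rewrite -expRM_natl => /(ler_wpM2r (expR_ge0 (n%:R * p))); apply: le_trans.
  rewrite -expRD ler_expR nk.
  rewrite -subr_ge0 opprK.
  have -> : (n%:R - k%:R) * - (p / (1 - p)) + n%:R * p + n%:R * p ^+ 2 / (1 - p) =
    k%:R * p / (1 - p) by field; rewrite gt_eqF.
  by rewrite divr_ge0 ?mulr_ge0// ltW.
have H : 1 - p <= expR (- p) by exact: expR_ge1Dx.
have := lerXn2r (n - k)%N (ltW q0) (expR_ge0 _) H.
rewrite -expRM_natl => /(ler_wpM2r (expR_ge0 (n%:R * p))) => /le_trans; apply.
by rewrite -expRD ler_expR nk le_eqVlt; apply/orP; left; apply/eqP; ring.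
Qed.

(** The Poisson approximation of a binomial weight combined with Stirling's
    formula.  The weight divided by its approximation is the product of a falling
    factorial over a power, of Stirling's quotient at k, and of
    (1 - p)^(n-k) e^(np); each factor tends to 1, which needs the squares of k and
    of np to be negligible with respect to n. *)
Lemma binom_pmf_equiv (k : nat -> nat) (p : nat -> R) :
  k @ \oo --> \oo -> (\forall n \near \oo, (k n <= n)%N) ->
  (\forall n \near \oo, 0 < p n < 1) -> p @ \oo --> 0 ->
  ((k n)%:R ^+ 2 / n%:R : R) @[n --> \oo] --> (0 : R) ->
  (n%:R * p n ^+ 2) @[n --> \oo] --> 0 ->
  binom_pmf n (p n) (k n) / ((Num.sqrt (2 * pi * (k n)%:R))^-1 *
     expR ((k n)%:R * rate (n%:R * p n / (k n)%:R))) @[n --> \oo] --> (1 : R).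
Proof.
move=> ky kn p01 p0 k2n np2.
pose A n : R := (n ^_ (k n))%:R / n%:R ^+ (k n).
pose B n : R := (k n)`!%:R / (Num.sqrt (2 * pi * (k n)%:R) * ((k n)%:R / expR 1) ^+ (k n)).
pose C n : R := (1 - p n) ^+ (n - k n) * expR (n%:R * p n).
have n_gt0 : \forall n \near \oo, (0 < n)%N by exact: nbhs_infty_gt.
have HA : A @ \oo --> (1 : R).
  apply: (@squeeze_cvgr _ _ _ _ (fun n => 1 - (k n)%:R ^+ 2 / n%:R) (cst 1)).
  - by apply: filterS n_gt0 => n n0; apply/andP; exact: ffact_ratio_bounds.
  - by rewrite -[X in _ --> X]subr0; apply: cvgB => //; exact: cvg_cst.
  - exact: cvg_cst.
have HB : B @ \oo --> (1 : R).
  exact: (cvg_comp k (fun n => n`!%:R / (Num.sqrt (2 * pi * n%:R) * (n%:R / expR 1) ^+ n)) ky (@stirling R)).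
have kp : (k n)%:R * p n @[n --> \oo] --> (0 : R).
  apply: (@squeeze_cvgr _ _ _ _ (cst 0) (fun n => (k n)%:R ^+ 2 / n%:R + n%:R * p n ^+ 2)).
  - near=> n.
    have n0 : 0 < n%:R :> R by rewrite ltr0n; near: n.
    have /andP[pn _] : 0 < p n < 1 by near: n.
    rewrite mulr_ge0 ?(ltW pn)//= -subr_ge0.
    (* kp is the geometric mean of the two bounding terms *)
    have -> : (k n)%:R ^+ 2 / n%:R + n%:R * p n ^+ 2 - (k n)%:R * p n =
       (((k n)%:R - n%:R * p n / 2) ^+ 2 + 3 / 4 * (n%:R * p n) ^+ 2) / n%:R.
      by field; rewrite gt_eqF.
    rewrite divr_ge0 ?(ltW n0)//; apply: addr_ge0; first exact: sqr_ge0.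
    by apply: mulr_ge0; [lra|exact: sqr_ge0].
  - exact: cvg_cst.
  - by rewrite -[X in _ --> X](addr0 0); exact: cvgD.
have HC : C @ \oo --> (1 : R).
  apply: (@squeeze_cvgr _ _ _ _ (fun n => expR (- (n%:R * p n ^+ 2 / (1 - p n))))
     (fun n => expR ((k n)%:R * p n))).
  - by near=> n; apply: onem_expn_bounds; near: n.
  - rewrite -[X in _ --> X](expR0 R); apply: cvg_expR.
    rewrite -[X in _ --> X]oppr0; apply: cvgN.
    rewrite -[X in _ --> X](mul0r (1 - 0)^-1); apply: cvgM => //.
    apply: cvgV; first by rewrite subr0 oner_eq0.
    by apply: cvgB => //; exact: cvg_cst.
  - by rewrite -[X in _ --> X](expR0 R); apply: cvg_expR.
have HH : A n * (B n)^-1 * C n @[n --> \oo] --> (1 : R).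
  rewrite -[X in _ --> X](_ : 1 * 1^-1 * 1 = 1); last by rewrite invr1 !mulr1.
  apply: cvgM => //; apply: cvgM => //; apply: cvgV => //; exact: oner_neq0.
apply: (cvg_near_eq _ HH); near=> n.
have n0 : 0 < n%:R :> R by rewrite ltr0n; near: n.
have k0 : (0 < k n)%N by near: n; move/cvgnyPgt : ky => /(_ 0%N).
have /andP[pn0 pn1] : 0 < p n < 1 by near: n.
have kR : 0 < (k n)%:R :> R by rewrite ltr0n.
have npk : 0 < n%:R * p n / (k n)%:R by rewrite !mulr_gt0 ?invr_gt0.
have -> : expR ((k n)%:R * rate (n%:R * p n / (k n)%:R)) =
  n%:R ^+ k n * p n ^+ k n / (k n)%:R ^+ k n * expR 1 ^+ k n / expR (n%:R * p n).
  have E : (k n)%:R * (n%:R * p n / (k n)%:R) = n%:R * p n.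
    by rewrite mulrC divfK ?gt_eqF.
  rewrite /rate mulrBr E mulrDr expRB expRD; congr (_ * _ / _).
    by rewrite expRM_natl lnK ?posrE// expr_div_n exprMn.
  by rewrite expRM_natl.
have -> : binom_pmf n (p n) (k n) =
    (n ^_ k n)%:R / (k n)`!%:R * p n ^+ k n * (1 - p n) ^+ (n - k n).
  by rewrite /binom_pmf -bin_ffact natrM mulfK// pnatr_eq0 -lt0n fact_gt0.
rewrite /A /B /C expr_div_n.
have f0 : (k n)`!%:R != 0 :> R by rewrite pnatr_eq0 -lt0n fact_gt0.
have s0 : Num.sqrt (2 * pi * (k n)%:R) != 0 :> R.
  by rewrite gt_eqF// sqrtr_gt0 !mulr_gt0// pi_gt0.
have e0 := lt0r_neq0 (expR_gt0 (n%:R * p n)).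
have nk0 : n%:R ^+ k n != 0 :> R by rewrite gt_eqF// exprn_gt0.
have pk0 : p n ^+ k n != 0 by rewrite gt_eqF// exprn_gt0.
have kk0 : (k n)%:R ^+ k n != 0 :> R by rewrite gt_eqF// exprn_gt0.
have ek0 : expR 1 ^+ k n != 0 :> R by rewrite gt_eqF// exprn_gt0// expR_gt0.
move: s0 f0 e0 nk0 pk0 kk0 ek0.
move: (Num.sqrt _) (_`!%:R) (expR _) (n%:R ^+ _) (p n ^+ _) ((k n)%:R ^+ _) (expR 1 ^+ _)
  (_ ^+ (n - _)) (_ ^_ _)%:R => a b c d' e f g h' i a0 b0 c0 d0 e0 f0 g0.
by field; rewrite a0 b0 c0 d0 e0 f0 g0.
Unshelve. all: by end_near. Qed.
End PmfEquiv.

(** * Weights at a root of the boundary equation *)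

Section BoundaryWeight.
Variable R : realType.

(** The Poisson form of the boundary equation: with l = k v, the equation
    (l - k)^2 = 2 x k l reads rel_gap v = x.  Its roots are inverse to each other;
    the one below 1 is [delta x]. *)
Definition rel_gap (v : R) : R := (v - 1) ^+ 2 / (2 * v).

(** Along the curve v |-> (rel_gap v, rate v) the slope is - 2v / (1 + v), and
    the tangent line is accurate to second order.  This turns the lower order
    terms of the critical value into the power with exponent 2v / (1 + v) of the
    final formulas. *)
Lemma rate_expansion (v w : R) : 0 < v -> 0 < w ->
  `|rate w - rate v + 2 * v / (1 + v) * (rel_gap w - rel_gap v)|
    <= (w - v) ^+ 2 / (v * w).
Proof.
move=> v0 w0.
have lnE : ln (w / v) = ln w - ln v by rewrite ln_div ?posrE.
have wv0 : 0 < w / v by rewrite divr_gt0.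
have up : ln (w / v) <= w / v - 1.
  have := @le_ln1Dx R (w / v - 1); rewrite [1 + _]addrC subrK; apply; lra.
have vw0 : 0 < v / w by rewrite divr_gt0.
have lo : 1 - v / w <= ln (w / v).
  have := @le_ln1Dx R (v / w - 1); rewrite [1 + _]addrC subrK.
  have -> : ln (v / w) = - ln (w / v) by rewrite -lnV ?posrE// invf_div.
  by move=> H; have := H _; lra.
have -> : rate w - rate v + 2 * v / (1 + v) * (rel_gap w - rel_gap v) =
  ln (w / v) - (w - v) * (1 + w) / (w * (1 + v)).
  rewrite lnE /rate /rel_gap; field.
  by rewrite !gt_eqF//; lra.
have e0 : 0 <= (w - v) ^+ 2 / (v * w) by rewrite divr_ge0 ?sqr_ge0// mulr_ge0// ltW.
have le1 : forall b, b <= 1 -> b * ((w - v) ^+ 2 / (v * w)) <= (w - v) ^+ 2 / (v * w).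
  by move=> b b1; rewrite ler_piMl.
rewrite ler_norml; apply/andP; split.
- apply: le_trans (lerB lo (lexx _)).
  rewrite lerNl opprB.
  apply: le_trans (le1 (v / (1 + v)) _).
    by rewrite le_eqVlt; apply/orP; left; apply/eqP; field; rewrite !gt_eqF//; lra.
  by rewrite ler_pdivrMr; lra.
- apply: le_trans (lerB up (lexx _)) _.
  apply: le_trans (le1 ((1 + v)^-1) _).
    by rewrite le_eqVlt; apply/orP; left; apply/eqP; field; rewrite !gt_eqF//; lra.
  by rewrite invf_le1; lra.
Qed.

(** Used twice: n is larger than exp (log log n), and log log n is the
    exponential of its own logarithm. *)
Lemma cvg_sqr_div_expR T (F : set_system T) {FF : Filter F} (f : T -> R) :
  f @ F --> +oo -> f x ^+ 2 / expR (f x) @[x --> F] --> 0.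
Proof.
move=> fy.
have f0 : \forall x \near F, 0 < f x by move/cvgryPgt : fy; exact.
apply: (@squeeze_cvgr _ _ _ _ (cst 0) (fun x => 27 * (f x)^-1)).
- apply: filterS f0 => x x0.
  rewrite divr_ge0 ?sqr_ge0 ?expR_ge0//=.
  rewrite ler_pdivrMr ?expR_gt0// mulrAC ler_pdivlMr//.
  have -> : expR (f x) = expR (f x / 3) ^+ 3.
    by rewrite -expRM_natl mulrC divfK.
  have H : f x / 3 <= expR (f x / 3).
    by apply: le_trans (expR_ge1Dx _); rewrite lerDr.
  have := lerXn2r 3 _ _ H; rewrite !nnegrE divr_ge0 ?expR_ge0 ?(ltW x0)// => /(_ isT isT).
  by rewrite expr_div_n ler_pdivrMr// -exprSr [leRHS]mulrC -natrX.
- exact: cvg_cst.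
- rewrite -[X in _ --> X](mulr0 27); apply: cvgM; first exact: cvg_cst.
  by apply/(@gtr0_cvgV0 R _ _ _ f).
Qed.

Lemma cvgry_ln T (F : set_system T) {FF : Filter F} (f : T -> R) :
  f @ F --> +oo -> ln (f x) @[x --> F] --> +oo.
Proof.
move=> fy; apply/cvgryPge => A; move/cvgryPge : fy => /(_ (expR A)).
apply: filterS => x Ax; rewrite -[A]expRK ler_ln// posrE ?expR_gt0//.
exact: lt_le_trans (expR_gt0 _) Ax.
Qed.

Lemma quadratic_bound (k l D p : R) : 0 <= k -> 0 <= l -> 0 <= D -> 0 <= p ->
  (l - k) ^+ 2 = D * l * (1 - p) -> l <= 2 * k + D.
Proof.
move=> k0 l0 D0 p0 E; rewrite leNgt; apply/negP => H.
have : D * l * (1 - p) <= D * l by rewrite ler_piMr ?mulr_ge0//; lra.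
rewrite -E; nra.
Qed.

Definition boundary_root (D n k p : R) : Prop :=
  0 < p < 1 /\ (n * p - k) ^+ 2 = D * (n * p) * (1 - p).

Lemma boundary_root_compl (D n k p : R) :
  boundary_root D n k p -> boundary_root D n (n - k) (1 - p).
Proof.
move=> [/andP[p0 p1] E]; split; first by rewrite subr_gt0 p1/= gtrBl.
transitivity ((n * p - k) ^+ 2); first by ring.
by rewrite E; ring.
Qed.

(** A Poisson variable of mean np would have variance np; the binomial variance
    np (1 - p) changes the datum of the equation by the factor 1 - p only. *)
Lemma rel_gap_boundary_root (D n k p : R) : 0 < n -> 0 < k ->
  boundary_root D n k p -> rel_gap (n * p / k) = D * (1 - p) / (2 * k).
Proof.
move=> n0 k0 [/andP[p0 p1] E]; rewrite /rel_gap.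
transitivity ((n * p - k) ^+ 2 / (2 * k * (n * p))).
  by field; rewrite !gt_eqF.
by rewrite E; field; rewrite !gt_eqF.
Qed.

Lemma cvg_rank (U : nat -> R) (k : nat -> nat) (a : R) :
  U @ \oo --> +oo -> U n ^+ 2 / n%:R @[n --> \oo] --> 0 ->
  0 < a -> (k n)%:R / U n @[n --> \oo] --> a ->
  [/\ k @ \oo --> \oo, (n - k n)%N @[n --> \oo] --> \oo,
      \forall n \near \oo, (0 < k n < n)%N &
      ((k n)%:R / n%:R : R) @[n --> \oo] --> (0 : R)].
Proof.
move=> Uy U2n a0 kU.
have U0 : \forall n \near \oo, 0 < U n by move/cvgryPgt : Uy; exact.
have UV : (U n)^-1 @[n --> \oo] --> (0 : R) by apply/(@gtr0_cvgV0 R _ _ _ U).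
have ky : k @ \oo --> \oo.
  apply/(@cvgrnyP R); apply/cvgryPge => A.
  near=> n.
  have Un : 0 < U n by near: n.
  have : a / 2 < (k n)%:R / U n by near: n; apply: (cvgr_gt _ kU); lra.
  rewrite ltr_pdivlMr// => /ltW; apply: le_trans.
  rewrite mulrC -ler_pdivrMr ?divr_gt0//.
  by near: n; move/cvgryPge : Uy; exact.
have kn : ((k n)%:R / n%:R : R) @[n --> \oo] --> (0 : R).
  have H : (k n)%:R / U n * (U n ^+ 2 / n%:R) * (U n)^-1 @[n --> \oo] --> a * 0 * 0.
    by apply: cvgM => //; exact: cvgM.
  rewrite mulr0 in H; apply: (cvg_near_eq _ H); near=> n.
  have Un : 0 < U n by near: n.
  by field; rewrite !gt_eqF// ltr0n; near: n; exact: nbhs_infty_gt.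
have kn2 : \forall n \near \oo, ((k n).*2 < n)%N.
  near=> n; have n0 : 0 < n%:R :> R by rewrite ltr0n; near: n; exact: nbhs_infty_gt.
  have : (k n)%:R / n%:R < 2^-1 :> R by near: n; apply: (cvgr_lt _ kn); rewrite invr_gt0.
  by rewrite ltr_pdivrMr// -(ltr_nat R) -muln2 natrM => H; lra.
split => //.
- apply/cvgnyPge => A; near=> n.
  have : ((k n).*2 < n)%N by near: n.
  have : (A <= k n)%N by near: n; move/cvgnyPge : ky; exact.
  rewrite -addnn => H1 H2; rewrite leq_subRL; last by rewrite (leq_trans _ (ltnW H2))// leq_addr.
  by rewrite (leq_trans _ (ltnW H2))// leq_add2l.
- near=> n; apply/andP; split; first by near: n; move/cvgnyPgt : ky; exact.
  have : ((k n).*2 < n)%N by near: n.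
  by rewrite -addnn; apply: leq_trans; rewrite ltnS leq_addr.
Unshelve. all: by end_near. Qed.

(** The weight at rank k when the success probability is a root of the boundary
    equation with D = 2U + 2b + o(1).  The relative mean w = np/k is the root
    [rho] of the equation with datum D (1 - p) / (2k), while v is the one with
    datum U / k.  By [binom_pmf_equiv] the weight has exponent k * rate w, and by
    [rate_expansion] this is k * rate v - b * (2v / (1 + v)), because the data
    differ by (b + o(1)) / k and k times the square of that is of order b^2 / U.
    The branch [rho] is left open: it is [delta] for the small ranks and its
    inverse for the large ones. *)
Lemma boundary_pmf_equiv (U D b : nat -> R) (k : nat -> nat) (p : nat -> R) (a : R)
    (rho : R -> R) :
  U @ \oo --> +oo -> U n ^+ 2 / n%:R @[n --> \oo] --> 0 ->
  b n ^+ 2 / U n @[n --> \oo] --> 0 ->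
  D n - 2 * U n - 2 * b n @[n --> \oo] --> 0 ->
  0 < a -> (k n)%:R / U n @[n --> \oo] --> a ->
  (\forall n \near \oo, 0 <= D n) ->
  (\forall n \near \oo, boundary_root (D n) n%:R (k n)%:R (p n)) ->
  (forall x, 0 < x -> 0 < rho x /\ rel_gap (rho x) = x) ->
  {for a^-1, continuous rho} -> rho a^-1 != 1 ->
  (\forall n \near \oo, rho (rel_gap (n%:R * p n / (k n)%:R)) = n%:R * p n / (k n)%:R) ->
  let v := fun n => rho (U n / (k n)%:R) in
  [/\ p @ \oo --> 0, n%:R * p n / (k n)%:R @[n --> \oo] --> rho a^-1,
   v @ \oo --> rho a^-1 &
  binom_pmf n (p n) (k n) / ((Num.sqrt (2 * pi * (k n)%:R))^-1 *
     expR ((k n)%:R * rate (v n) - b n * (2 * v n / (1 + v n)))) @[n --> \oo] --> (1 : R)].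
Proof.
move=> Uy U2n b2U HD a0 kU D0 root rhoP rhoC rho1 rho_gap v.
have [ky _ k_in _] := cvg_rank Uy U2n a0 kU.
have n0 : \forall n \near \oo, 0 < n%:R :> R.
  by near=> n; rewrite ltr0n; near: n; exact: nbhs_infty_gt.
have k0 : \forall n \near \oo, 0 < (k n)%:R :> R.
  by apply: filterS k_in => n /andP[+ _]; rewrite ltr0n.
have kn : \forall n \near \oo, (k n <= n)%N.
  by apply: filterS k_in => n /andP[_ /ltnW].
have p01 : \forall n \near \oo, 0 < p n < 1 by apply: filterS root => n [].
have U0 : \forall n \near \oo, 0 < U n by move/cvgryPgt : Uy; exact.
have UV : (U n)^-1 @[n --> \oo] --> (0 : R) by apply/(@gtr0_cvgV0 R _ _ _ U).
have Un0 : U n / n%:R @[n --> \oo] --> 0.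
  rewrite -[X in _ --> X](mulr0 0); apply: (cvg_near_eq _ (cvgM U2n UV)).
  near=> n; have Un : 0 < U n by near: n.
  by rewrite /=; field; rewrite !gt_eqF//; near: n.
have bU : b n / U n @[n --> \oo] --> 0.
  have H : b n ^+ 2 / U n + (U n)^-1 @[n --> \oo] --> (0 : R).
    by rewrite -[X in _ --> X](addr0 0); exact: cvgD.
  apply: (@squeeze_cvgr _ _ _ _ (fun n => - (b n ^+ 2 / U n + (U n)^-1))
     (fun n => b n ^+ 2 / U n + (U n)^-1)) => //; last first.
    by rewrite -[X in _ --> X]oppr0; exact: cvgN.
  near=> n; have Un : 0 < U n by near: n.
  rewrite -[X in _ + X]mul1r -mulrDl -mulNr !ler_pM2r ?invr_gt0//.
  by apply/andP; split; nra.
have DU : D n / U n @[n --> \oo] --> (2 : R).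
  have H : (D n - 2 * U n - 2 * b n) / U n + (2 + 2 * (b n / U n)) @[n --> \oo]
     --> (0 * 0 + (2 + 2 * 0) : R).
    apply: cvgD; first exact: cvgM.
    by apply: cvgD; [exact: cvg_cst|apply: cvgM => //; exact: cvg_cst].
  rewrite !mulr0 addr0 add0r in H; apply: (cvg_near_eq _ H); near=> n.
  have Un : 0 < U n by near: n.
  by field; rewrite gt_eqF.
(* S U bounds the mean np, so np is of the order of U *)
pose S n := (2 * (k n)%:R + D n) / U n.
have HS : S @ \oo --> 2 * a + 2.
  have H : 2 * ((k n)%:R / U n) + D n / U n @[n --> \oo] --> 2 * a + 2.
    by apply: cvgD => //; apply: cvgM => //; exact: cvg_cst.
  by apply: (cvg_near_eq _ H); near=> n; rewrite /S mulrDl mulrA.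
have pS : \forall n \near \oo, n%:R * p n <= S n * U n.
  near=> n; have Un : 0 < U n by near: n.
  rewrite /S divfK ?gt_eqF//; apply: (@quadratic_bound _ _ _ (p n)) => //.
  - have /andP[+ _] : 0 < p n < 1 by near: n.
    by move=> /ltW ?; rewrite mulr_ge0.
  - by near: n.
  - have /andP[+ _] : 0 < p n < 1 by near: n.
    exact: ltW.
  - suff [] : boundary_root (D n) n%:R (k n)%:R (p n) by [].
    by near: n.
have Hp : p @ \oo --> 0.
  apply: (@squeeze_cvgr _ _ _ _ (cst 0) (fun n => S n * (U n / n%:R))).
  - near=> n; have /andP[pn _] : 0 < p n < 1 by near: n.
    rewrite (ltW pn)/= mulrA ler_pdivlMr; last by near: n.
    by rewrite mulrC; near: n.
  - exact: cvg_cst.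
  - by rewrite -[X in _ --> X](mulr0 (2 * a + 2)); exact: cvgM.
have Hnp2 : n%:R * p n ^+ 2 @[n --> \oo] --> 0.
  apply: (@squeeze_cvgr _ _ _ _ (cst 0) (fun n => S n * S n * (U n ^+ 2 / n%:R))).
  - near=> n; have /andP[pn _] : 0 < p n < 1 by near: n.
    have nn : 0 < n%:R :> R by near: n.
    have H : n%:R * p n <= S n * U n by near: n.
    rewrite mulr_ge0 ?sqr_ge0//= mulrA ler_pdivlMr//.
    have -> : n%:R * p n ^+ 2 * n%:R = (n%:R * p n) ^+ 2 by ring.
    have -> : S n * S n * U n ^+ 2 = (S n * U n) ^+ 2 by ring.
    have np0 : 0 <= n%:R * p n by rewrite mulr_ge0// ltW.
    by apply: lerXn2r => //; rewrite nnegrE// (le_trans np0).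
  - exact: cvg_cst.
  - rewrite -[X in _ --> X](mulr0 ((2 * a + 2) * (2 * a + 2))).
    by apply: cvgM => //; exact: cvgM.
have HDp : D n * p n @[n --> \oo] --> 0.
  apply: (@squeeze_cvgr _ _ _ _ (cst 0) (fun n => D n / U n * S n * (U n ^+ 2 / n%:R))).
  - near=> n; have /andP[pn _] : 0 < p n < 1 by near: n.
    have nn : 0 < n%:R :> R by near: n.
    have Un : 0 < U n by near: n.
    have H : n%:R * p n <= S n * U n by near: n.
    have Dn : 0 <= D n by near: n.
    rewrite mulr_ge0 ?(ltW pn)//= mulrA ler_pdivlMr//.
    have -> : D n * p n * n%:R = D n * (n%:R * p n) by ring.
    have -> : D n / U n * S n * U n ^+ 2 = D n * (S n * U n).
      by field; rewrite gt_eqF.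
    exact: ler_wpM2l.
  - exact: cvg_cst.
  - rewrite -[X in _ --> X](mulr0 (2 * (2 * a + 2))).
    by apply: cvgM => //; exact: cvgM.
have Hk2n : (k n)%:R ^+ 2 / n%:R @[n --> \oo] --> (0 : R).
  have H : ((k n)%:R / U n) * ((k n)%:R / U n) * (U n ^+ 2 / n%:R) @[n --> \oo] --> a * a * 0.
    by apply: cvgM => //; exact: cvgM.
  rewrite mulr0 in H; apply: (cvg_near_eq _ H); near=> n.
  have Un : 0 < U n by near: n.
  by field; rewrite !gt_eqF//; near: n.
pose X n := D n * (1 - p n) / (2 * (k n)%:R).
have HX : X @ \oo --> a^-1.
  have H : 2^-1 * (D n / U n) * (1 - p n) * ((k n)%:R / U n)^-1 @[n --> \oo]
     --> 2^-1 * 2 * (1 - 0) * a^-1.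
    apply: cvgM; last by apply: cvgV => //; rewrite gt_eqF.
    apply: cvgM; last by apply: cvgB => //; exact: cvg_cst.
    by apply: cvgM => //; exact: cvg_cst.
  rewrite subr0 mulVf// !mul1r in H; apply: (cvg_near_eq _ H); near=> n.
  have Un : 0 < U n by near: n.
  have kk : 0 < (k n)%:R :> R by near: n.
  by rewrite /X; field; rewrite !gt_eqF.
pose x n := U n / (k n)%:R.
have Hx : x @ \oo --> a^-1.
  have H : ((k n)%:R / U n)^-1 @[n --> \oo] --> a^-1 by apply: cvgV => //; rewrite gt_eqF.
  by apply: (cvg_near_eq _ H); near=> n; rewrite /x invf_div.
pose w n := n%:R * p n / (k n)%:R.
have wE : \forall n \near \oo, w n = rho (X n).
  near=> n; have nn : 0 < n%:R :> R by near: n.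
  have kk : 0 < (k n)%:R :> R by near: n.
  have rt : boundary_root (D n) n%:R (k n)%:R (p n) by near: n.
  rewrite /X -(rel_gap_boundary_root nn kk rt).
  by apply/esym; rewrite /w; near: n.
have Hw : w @ \oo --> rho a^-1.
  have H : rho (X n) @[n --> \oo] --> rho a^-1 by exact: continuous_cvg.
  exact: (cvg_near_eq _ H).
have Hv : v @ \oo --> rho a^-1 by exact: continuous_cvg.
split => //.
(* k (X - x) = b + eps *)
pose eps n := (D n - 2 * U n - 2 * b n) * 2^-1 - D n * p n * 2^-1.
have Heps : eps @ \oo --> 0.
  rewrite -[X in _ --> X](subrr (0 * 2^-1)).
  by apply: cvgB; apply: cvgM => //; exact: cvg_cst.
pose l := rho a^-1.
have l0 : 0 < l by have [] := rhoP a^-1; rewrite ?invr_gt0.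
have l21 : l * l - 1 != 0.
  rewrite -expr2 subr_sqr_1 mulf_neq0 ?subr_eq0//.
  by rewrite gt_eqF// addr_gt0.
(* Q is the second order error k (w - v)^2 / (v w) of the expansion *)
pose Q n := 4 * ((b n + eps n) ^+ 2 / U n) * x n * (v n * w n / (v n * w n - 1) ^+ 2).
have Hbe : (b n + eps n) ^+ 2 / U n @[n --> \oo] --> 0.
  apply: (@squeeze_cvgr _ _ _ _ (cst 0) (fun n => 2 * (b n ^+ 2 / U n) + 2 * (eps n * eps n * (U n)^-1))).
  - near=> n; have Un : 0 < U n by near: n.
    rewrite divr_ge0 ?sqr_ge0 ?(ltW Un)//=.
    have -> : 2 * (b n ^+ 2 / U n) + 2 * (eps n * eps n * (U n)^-1) =
      (2 * b n ^+ 2 + 2 * eps n ^+ 2) / U n by ring.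
    by rewrite ler_pM2r ?invr_gt0//; have := sqr_ge0 (b n - eps n); lra.
  - exact: cvg_cst.
  - rewrite -[X in _ --> X](_ : 2 * 0 + 2 * (0 * 0 * 0) = 0); last by rewrite !mulr0 addr0.
    apply: cvgD; first by apply: cvgM => //; exact: cvg_cst.
    apply: cvgM; first exact: cvg_cst.
    by apply: cvgM => //; exact: cvgM.
have Hvw : v n * w n @[n --> \oo] --> l * l by exact: cvgM.
have HQ : Q @ \oo --> 0.
  have H : Q @ \oo --> 4 * 0 * a^-1 * (l * l * (l * l - 1)^-2).
    apply: cvgM.
      by apply: cvgM => //; apply: cvgM => //; exact: cvg_cst.
    apply: cvgM => //; apply: cvgV; first by rewrite expf_neq0.
    by apply: cvgM; apply: cvgB => //; exact: cvg_cst.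
  by rewrite mulr0 !mul0r in H.
pose E n := (k n)%:R * (rate (w n) - rate (v n)) + b n * (2 * v n / (1 + v n)).
have HE : E @ \oo --> 0.
  have H : Q n + 2 * `|eps n| @[n --> \oo] --> 0.
    rewrite -[X in _ --> X](_ : 0 + 2 * `|0 : R| = 0); last by rewrite normr0 mulr0 addr0.
    by apply: cvgD => //; apply: cvgM; [exact: cvg_cst|exact: cvg_norm].
  apply: norm_cvg0; apply: (@squeeze_cvgr _ _ _ _ (cst 0) (fun n => Q n + 2 * `|eps n|)) => //;
    last exact: cvg_cst.
  near=> n; rewrite normr_ge0/=.
  have Un : 0 < U n by near: n.
  have kk : 0 < (k n)%:R :> R by near: n.
  have xn : 0 < x n by rewrite divr_gt0.
  have [vn gv] : 0 < v n /\ rel_gap (v n) = x n by exact: rhoP.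
  have wnE : w n = rho (X n) by near: n.
  have Xn : 0 < X n by near: n; apply: (cvgr_gt _ HX); rewrite invr_gt0.
  have [wn gw] : 0 < w n /\ rel_gap (w n) = X n by rewrite wnE; exact: rhoP.
  have vw1 : v n * w n - 1 != 0.
    by near: n; apply: (cvgr_neq0 _ _ l21); apply: cvgB => //; exact: cvg_cst.
  have := rate_expansion vn wn.
  rewrite gv gw => Hexp.
  have kX : (k n)%:R * (X n - x n) = b n + eps n.
    by rewrite /X /x /eps; field; rewrite gt_eqF.
  have -> : E n = (k n)%:R * (rate (w n) - rate (v n) + 2 * v n / (1 + v n) * (X n - x n))
     - 2 * v n / (1 + v n) * eps n.
    rewrite mulrDr mulrCA kX /E; ring.
  apply: le_trans (ler_normB _ _) _; apply: lerD.
    rewrite normrM gtr0_norm//.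
    apply: le_trans (ler_wpM2l (ltW kk) Hexp) _.
    rewrite le_eqVlt; apply/orP; left; apply/eqP.
    have dE : (w n - v n) = 2 * (X n - x n) * (v n * w n) / (v n * w n - 1).
      rewrite -gv -gw /rel_gap; field.
      by rewrite vw1 !gt_eqF.
    rewrite dE.
    rewrite /Q -kX /x; field.
    by rewrite vw1 !gt_eqF.
  rewrite normrM ler_wpM2r// ger0_norm; last by rewrite divr_ge0 ?mulr_ge0// ltW// addr_gt0.
  by rewrite ler_pdivrMr; lra.
have HH := binom_pmf_equiv ky kn p01 Hp Hk2n Hnp2.
have HF : binom_pmf n (p n) (k n) / ((Num.sqrt (2 * pi * (k n)%:R))^-1 *
     expR ((k n)%:R * rate (w n))) * expR (E n) @[n --> \oo] --> (1 * expR 0 : R).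
  by apply: cvgM => //; exact: cvg_expR.
rewrite expR0 mulr1 in HF.
apply: (cvg_near_eq _ HF); near=> n.
have -> : (k n)%:R * rate (w n) = ((k n)%:R * rate (v n) - b n * (2 * v n / (1 + v n))) + E n.
  by rewrite /E; ring.
rewrite [expR (_ + E n)]expRD.
have kk : 0 < (k n)%:R :> R by near: n.
have s0 : 0 < Num.sqrt (2 * pi * (k n)%:R) :> R.
  by rewrite sqrtr_gt0 !mulr_gt0// pi_gt0.
have e1 := expR_gt0 ((k n)%:R * rate (v n) - b n * (2 * v n / (1 + v n))).
have e2 := expR_gt0 (E n).
move: (Num.sqrt _) (expR (_ - _)) (expR (E n)) s0 e1 e2 => A B C A0 B0 C0.
by field; rewrite !gt_eqF.
Unshelve. all: by end_near.
Qed.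
End BoundaryWeight.

(** * The law of an order statistic *)

Lemma order_statistic_lt (R : realType) n (x : 'I_n -> R) i (y : R) :
  (1 <= i <= n)%N ->
  (order_statistic x i < y) = (i <= #|[set j | (x j < y)%R]%SET|)%N.
Proof.
case: i => [//|i] /= iN; rewrite /order_statistic /=.
set s := sort _ _.
have ss : sorted <=%O s by apply: sort_sorted; exact: le_total.
have cs : count (< y)%O s = #|[set j | x j < y]%SET|.
  rewrite count_sort count_map -sum1_count -sum1_card big_enum_cond/=.
  by apply: eq_bigl => j; rewrite inE.
have sz : size s = n by rewrite size_sort size_map size_enum_ord.
rewrite -cs; apply/idP/idP => [H|H].
  rewrite leqNgt; apply/negP => ci.
  have : y <= nth 0 s i.
    by apply: nth_count_ge => //; rewrite sz -ltnS ci.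
  by rewrite leNgt H.
exact: nth_count_lt.
Qed.

Lemma uniform_prob_lt (R : realType) (y : R) : 0 <= y <= 1 ->
  uniform_prob (@ltr01 R) [set r | r < y] = y%:E.
Proof.
move=> /andP[y0 y1]; rewrite /uniform_prob integral_uniform_pdf.
have -> : [set r : R | r < y] `&` `[0, 1]%classic = `[0, y[%classic.
  apply/seteqP; split => r /=; rewrite !in_itv/=.
    by move=> [ry /andP[r0 r1]]; rewrite r0 ry.
  by move=> /andP[r0 ry]; rewrite r0 ry (le_trans (ltW ry)).
under eq_integral => r.
  rewrite inE/= in_itv/= => /andP[r0 ry].
  rewrite /uniform_pdf r0 (le_trans (ltW ry) y1)/= subr0 invr1.
  over.
rewrite integral_cst//= mul1e lebesgue_measure_itv/= lte_fin.
by case: ltgtP y0 => //= [_ _|<- _]; rewrite -?EFinB ?subr0.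
Qed.

Section OrderStatisticLaw.
Variables (R : realType) (disp : measure_display) (T : measurableType disp).
Variables (P : probability T R) (n : nat) (X : 'I_n -> {RV P >-> R}).
Hypothesis X_iid : iid_uniform01 X.
Variable y : R.
Hypothesis y01 : 0 <= y <= 1.

Let B (J : {set 'I_n}) (j : 'I_n) : set R :=
  if j \in J then [set r | r < y] else ~` [set r | r < y].

Let measurable_lt : measurable [set r : R | r < y].
Proof.
rewrite (_ : [set r | r < y] = `]-oo, y[%classic); first exact: measurable_itv.
by apply/seteqP; split=> r /=; rewrite in_itv.
Qed.

Let measurableB J j : measurable (B J j).
Proof. by rewrite /B; case: ifP => _ //; exact: measurableC. Qed.

Let probB J j : P (X j @^-1` B J j) = (if j \in J then y else 1 - y)%:E.
Proof.
have [_ XU] := X_iid.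
have Py : P (X j @^-1` [set r | r < y]) = y%:E.
  by rewrite -(uniform_prob_lt y01) -(XU j).
rewrite /B; case: ifP => _ //.
have mX : measurable (X j @^-1` [set r | r < y]).
  by rewrite -[_ @^-1` _]setTI; exact: measurable_funP.
by rewrite preimage_setC probability_setC// Py.
Qed.

Definition below_set (w : T) : {set 'I_n} := [set j | X j w < y]%SET.

Let below_setE J :
  [set w | below_set w = J] = \bigcap_(j in [set j | j \in [set: 'I_n]%SET]) (X j @^-1` B J j).
Proof.
apply/seteqP; split => w /=.
  by move=> <- j _; rewrite /B/= inE; case: ifPn => //= /negP.
move=> H; apply/setP => j; rewrite inE.
by have := H j; rewrite /= inE => /(_ isT); rewrite /B/=; case: ifP => //= _ /negP/negbTE.
Qed.

Let measurable_below_set J : measurable [set w | below_set w = J].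
Proof.
rewrite below_setE; apply: fin_bigcap_measurable => // j _.
by rewrite -[_ @^-1` _]setTI; exact: measurable_funP.
Qed.

Let prob_below_set J :
  P [set w | below_set w = J] = (y ^+ #|J| * (1 - y) ^+ (n - #|J|))%:E.
Proof.
have [XI _] := X_iid.
rewrite below_setE (XI _ (B J))//.
under eq_bigr do rewrite probB.
rewrite prodEFin; congr EFin.
rewrite (bigID (mem J))/=; congr (_ * _).
  rewrite (eq_bigr (fun=> y)) => [|j /andP[_ ->]//].
  by rewrite prodr_const; congr (_ ^+ _); apply: eq_card => j; rewrite unfold_in /= inE.
rewrite (eq_bigr (fun=> 1 - y)) => [|j /andP[_ /negbTE->]//].
rewrite prodr_const; congr (_ ^+ _).
have := cardsC J; rewrite card_ord => nE.
have -> : (n - #|J| = #|~: J|)%N.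
  apply/eqP; rewrite -(eqn_add2l #|J|) subnKC ?nE//.
  by have := max_card (mem J); rewrite card_ord.
by apply: eq_card => j; rewrite unfold_in /= !inE.
Qed.

(** The event is the disjoint union over the sets J of at least i indices of the
    events that J is exactly the set of indices whose variable is below y;
    independence gives each of them probability y^|J| (1-y)^(n-|J|). *)
Lemma prob_order_statistic_lt i : (1 <= i <= n)%N ->
  P [set w | order_statistic (fun j => X j w) i < y] = (binom_tail n y i)%:E.
Proof.
move=> i1n.
have -> : [set w | order_statistic (fun j => X j w) i < y] =
  \bigcup_(J in [set` enum [pred J : {set 'I_n} | i <= #|J|]%N]) [set w | below_set w = J].
  apply/seteqP; split => w /=; rewrite order_statistic_lt//.
    by move=> H; exists (below_set w) => //=; rewrite mem_enum.
  by move=> [J /= + E]; rewrite mem_enum -E.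
rewrite measure_fin_bigcup//; last first.
  by move=> J J' _ _ [w [/= -> ->]].
rewrite -fsbig_seq ?enum_uniq// big_enum/=.
under eq_bigr do rewrite prob_below_set.
rewrite sumEFin; congr EFin.
rewrite (partition_big (fun J : {set 'I_n} => inord #|J| : 'I_n.+1) (fun m => i <= m)%N)/=; last first.
  by move=> J; rewrite inE => iJ; rewrite inordK// ltnS (leq_trans (max_card _))// card_ord.
rewrite /binom_tail big_geq_mkord; apply: eq_bigr => m im.
rewrite (eq_bigl (fun J : {set 'I_n} => #|J| == m)) => [|J]; last first.
  have Jn : (#|J| < n.+1)%N by rewrite ltnS (leq_trans (max_card _))// card_ord.
  rewrite inE -val_eqE /= inordK// andbC; case: eqP => //= ->.
  exact: im.
rewrite (eq_bigr (fun=> y ^+ m * (1 - y) ^+ (n - m))) => [|J /eqP->//].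
rewrite -big_set /= sumr_const card_draws card_ord.
by rewrite /binom_pmf -mulrA mulr_natl.
Qed.
End OrderStatisticLaw.

(** * The function delta and the critical values h *)

Section Delta.
Variable R : realType.
Implicit Types v x : R.

Lemma rel_gapV v : 0 < v -> rel_gap v^-1 = rel_gap v.
Proof. by move=> v0; rewrite /rel_gap; field; rewrite gt_eqF. Qed.

Lemma delta_itv x : 0 < x -> 0 < delta x < 1.
Proof.
move=> x0; rewrite /delta; set s := Num.sqrt _.
have s0 : 0 <= s by exact: sqrtr_ge0.
have sE : s ^+ 2 = x ^+ 2 + 2 * x by rewrite sqr_sqrtr// addr_ge0 ?sqr_ge0// mulr_ge0// ltW.
by apply/andP; split; nra.
Qed.

Lemma rel_gap_delta x : 0 < x -> rel_gap (delta x) = x.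
Proof.
move=> x0; have /andP[+ _] := delta_itv x0; rewrite /rel_gap /delta; set s := Num.sqrt _ => d0.
have sE : s ^+ 2 = x ^+ 2 + 2 * x by rewrite sqr_sqrtr// addr_ge0 ?sqr_ge0// mulr_ge0// ltW.
apply: (@mulIf _ (2 * (1 + x - s))); first by rewrite gt_eqF// mulr_gt0.
by rewrite divfK ?gt_eqF// ?mulr_gt0//; ring: sE.
Qed.

Lemma delta_rel_gap v : 0 < v < 1 -> delta (rel_gap v) = v.
Proof.
move=> /andP[v0 v1]; rewrite /delta.
have -> : rel_gap v ^+ 2 + 2 * rel_gap v = (((v^-1 - v) / 2)) ^+ 2.
  by rewrite /rel_gap; field; rewrite gt_eqF.
rewrite sqrtr_sqr ger0_norm; last by rewrite divr_ge0// subr_ge0 (le_trans (ltW v1))// ltW// invf_gt1.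
by rewrite /rel_gap; field; rewrite gt_eqF.
Qed.

Lemma continuous_delta x : {for x, continuous (@delta R)}.
Proof.
rewrite /continuous_at /delta; apply: cvgB.
  by apply: cvgD; [exact: cvg_cst|exact: cvg_id].
apply: cvg_sqrt; apply: cvgD; first by apply: cvgM; exact: cvg_id.
by apply: cvgM; [exact: cvg_cst|exact: cvg_id].
Qed.

(** [h i n x] is the smaller root of the quadratic equation saying that the
    standardized distance between i and the binomial mean is x. *)
Lemma h_root (i n : nat) x : 0 < x -> (0 < i < n)%N ->
  boundary_root (x ^+ 2) n%:R i%:R (h i n x) /\ n%:R * h i n x < i%:R.
Proof.
move=> x0 /andP[i0 iN].
have [iR nR] : 0 < i%:R :> R /\ i%:R < n%:R :> R by rewrite ltr0n ltr_nat.
rewrite /h; set I := i%:R : R; set N := n%:R : R; set s := Num.sqrt _.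
have N0 : 0 < N by lra.
have s0 : 0 <= s by exact: sqrtr_ge0.
have E : x ^+ 2 + 4 * I - 4 * I ^+ 2 / N = x ^+ 2 + 4 * (I * (N - I) / N).
  by field; rewrite gt_eqF.
have e0 : 0 < I * (N - I) / N by rewrite divr_gt0// mulr_gt0// subr_gt0.
have sE : s ^+ 2 = x ^+ 2 + 4 * (I * (N - I) / N).
  by rewrite /s E sqr_sqrtr// addr_ge0 ?sqr_ge0// mulr_ge0// ltW.
have {e0 E}sE : N * s ^+ 2 = N * x ^+ 2 + 4 * (I * (N - I)).
  by rewrite sE; field; rewrite gt_eqF.
have x20 : 0 < x ^+ 2 by rewrite exprn_gt0.
set D := x ^+ 2 + N.
have D0 : 0 < D by rewrite addr_gt0.
set p := _ / _.
have pE : 2 * D * p = x ^+ 2 + 2 * I - x * s.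
  by rewrite /p mulrC divfK// gt_eqF// mulr_gt0.
(* conjugate expression: the product of the two roots is I^2 / (N D) *)
have prod : N * (2 * D * p) * (x ^+ 2 + 2 * I + x * s) = 4 * D * I ^+ 2.
  rewrite pE.
  have -> : N * (x ^+ 2 + 2 * I - x * s) * (x ^+ 2 + 2 * I + x * s) =
     N * (x ^+ 2 + 2 * I) ^+ 2 - x ^+ 2 * (N * s ^+ 2) by ring.
  by rewrite sE /D; ring.
have p0 : 0 < p.
  have : 0 < N * (2 * D * p) * (x ^+ 2 + 2 * I + x * s).
    by rewrite prod !mulr_gt0// exprn_gt0.
  rewrite pmulr_lgt0; last by rewrite ltr_wpDr// ?mulr_ge0// ?(ltW x0)// addr_gt0// mulr_gt0.
  by rewrite pmulr_rgt0// pmulr_rgt0// mulr_gt0.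
have Np : N * p < I.
  have H : x * (N - 2 * I) < N * s.
    rewrite ltNge; apply/negP => H.
    have : (N * s) ^+ 2 <= (x * (N - 2 * I)) ^+ 2.
      have Ns0 : 0 <= N * s by rewrite mulr_ge0// ltW.
      by apply: lerXn2r => //; rewrite nnegrE// (le_trans Ns0).
    apply/negP; rewrite -ltNge -subr_gt0.
    have -> : (N * s) ^+ 2 - (x * (N - 2 * I)) ^+ 2 =
       N * (N * s ^+ 2) - x ^+ 2 * (N - 2 * I) ^+ 2 by ring.
    rewrite sE.
    have -> : N * (N * x ^+ 2 + 4 * (I * (N - I))) - x ^+ 2 * (N - 2 * I) ^+ 2 =
      4 * (I * (N - I)) * (N + x ^+ 2) by ring.
    have NI0 : 0 < N - I by rewrite subr_gt0.
    by rewrite mulr_gt0 ?addr_gt0// mulr_gt0// mulr_gt0.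
  rewrite -(ltr_pM2l (_ : 0 < 2 * D)); last by rewrite mulr_gt0.
  have -> : 2 * D * (N * p) = N * (2 * D * p) by ring.
  rewrite pE -subr_gt0.
  have -> : 2 * D * I - N * (x ^+ 2 + 2 * I - x * s) = x * (N * s - x * (N - 2 * I)).
    by rewrite /D; ring.
  by rewrite mulr_gt0// subr_gt0.
have quad : D * N * p ^+ 2 - N * (x ^+ 2 + 2 * I) * p + I ^+ 2 = 0.
  have : N * (2 * D * p - (x ^+ 2 + 2 * I)) ^+ 2 = x ^+ 2 * (N * s ^+ 2) by rewrite pE; ring.
  rewrite sE => H.
  apply: (@mulfI _ (4 * D)); first by rewrite gt_eqF// mulr_gt0.
  rewrite mulr0.
  transitivity (N * (2 * D * p - (x ^+ 2 + 2 * I)) ^+ 2 - x ^+ 2 * (N * x ^+ 2 + 4 * (I * (N - I)))).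
    by rewrite /D; ring.
  by rewrite H subrr.
split => //; split.
- by rewrite p0/= -(ltr_pM2l N0) mulr1 (lt_trans Np).
- apply/eqP; rewrite -subr_eq0; apply/eqP; rewrite -[RHS]quad /D; ring.
Qed.

End Delta.


(** * Asymptotics of u and d *)

Section Asymptotics.
Variable R : realType.

(** The lower order part of the numerator of [d t n], which is 2u + drift; then
    d^2 = 2u + 2 drift + o(1), and exp (- drift) is the base
    sqrt pi e^(-t) / sqrt u of the power in the final formulas. *)
Definition drift (t : R) n : R := t + (ln (u n) - ln pi) / 2.

Lemma cvgry_ln_nat : ln (n%:R : R) @[n --> \oo] --> +oo.
Proof. by apply: cvgry_ln; exact: cvgr_idn. Qed.

Lemma cvgry_u : @u R @ \oo --> +oo.
Proof. by apply: cvgry_ln; exact: cvgry_ln_nat. Qed.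

Lemma expR_u_near : \forall n \near \oo, expR (u n) = ln n%:R :> R.
Proof.
near=> n; rewrite /u lnK// posrE; near: n.
by move/cvgryPgt : cvgry_ln_nat; exact.
Unshelve. all: by end_near. Qed.

Lemma cvg_sqr_u_div : (u n ^+ 2 / n%:R : R) @[n --> \oo] --> (0 : R).
Proof.
apply: (@squeeze_cvgr _ _ _ _ (cst 0) (fun n => u n ^+ 2 / expR (u n))).
- near=> n.
  have n0 : 0 < n%:R :> R by rewrite ltr0n; near: n; exact: nbhs_infty_gt.
  rewrite divr_ge0 ?sqr_ge0//= ler_wpM2l ?sqr_ge0// lef_pV2 ?posrE ?expR_gt0//.
  have -> : expR (u n) = ln n%:R :> R by near: n; exact: expR_u_near.
  have := @le_ln1Dx R (n%:R - 1); rewrite [1 + _]addrC subrK => H.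
  by apply: le_trans (H _) _; lra.
- exact: cvg_cst.
- by apply: cvg_sqr_div_expR; exact: cvgry_u.
Unshelve. all: by end_near. Qed.

Lemma cvg_sqr_drift_div t : (drift t n ^+ 2 / u n : R) @[n --> \oo] --> (0 : R).
Proof.
pose c := t - ln pi / 2.
have lnuy : ln (@u R n) @[n --> \oo] --> +oo by apply: cvgry_ln; exact: cvgry_u.
have u0 : \forall n \near \oo, 0 < @u R n by move/cvgryPgt : cvgry_u; exact.
have uV : (@u R n)^-1 @[n --> \oo] --> 0 by apply/(@gtr0_cvgV0 R _ _ _ u) => //; exact: cvgry_u.
apply: (@squeeze_cvgr _ _ _ _ (cst 0)
  (fun n => 2 * c ^+ 2 * (u n)^-1 + 2^-1 * (ln (u n) ^+ 2 / expR (ln (u n))))).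
- near=> n; have un : 0 < u n :> R by near: n.
  rewrite divr_ge0 ?sqr_ge0 ?(ltW un)//= lnK ?posrE//.
  have -> : 2 * c ^+ 2 / u n + 2^-1 * (ln (u n) ^+ 2 / u n) =
     (2 * c ^+ 2 + 2^-1 * ln (u n) ^+ 2) / u n by ring.
  rewrite ler_pM2r ?invr_gt0//.
  have -> : drift t n = c + ln (u n) / 2 by rewrite /drift /c; ring.
  by have := sqr_ge0 (c - ln (u n) / 2); nra.
- exact: cvg_cst.
- rewrite -[X in _ --> X](_ : 2 * c ^+ 2 * 0 + 2^-1 * 0 = 0); last by rewrite !mulr0 addr0.
  apply: cvgD; apply: cvgM => //; try exact: cvg_cst.
  exact: cvg_sqr_div_expR.
Unshelve. all: by end_near. Qed.

Lemma d_near t : \forall n \near \oo,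
  0 < d t n /\ d t n ^+ 2 = 2 * u n + 2 * drift t n + drift t n ^+ 2 / (2 * u n) :> R.
Proof.
have u0 : \forall n \near \oo, 0 < @u R n by move/cvgryPgt : cvgry_u; exact.
near=> n; have un : 0 < u n :> R by near: n.
have dE : d t n = (2 * u n + drift t n) / Num.sqrt (2 * u n).
  by rewrite /d /drift; congr (_ / _); ring.
split.
  rewrite dE divr_gt0// ?sqrtr_gt0 ?mulr_gt0//.
  have : drift t n ^+ 2 / u n < 1 by near: n; apply: (cvgr_lt _ (cvg_sqr_drift_div t)); exact: ltr01.
  have u1 : 1 < u n :> R by near: n; move/cvgryPgt : cvgry_u; exact.
  by rewrite ltr_pdivrMr//; nra.
rewrite dE expr_div_n sqr_sqrtr; last by rewrite mulr_ge0// ltW.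
by field; rewrite gt_eqF.
Unshelve. all: by end_near. Qed.

Lemma cvg_d_sqr t : (d t n ^+ 2 - 2 * u n - 2 * drift t n : R) @[n --> \oo] --> (0 : R).
Proof.
have H : 2^-1 * (drift t n ^+ 2 / u n) @[n --> \oo] --> (2^-1 * 0 : R).
  by apply: cvgM; [exact: cvg_cst|exact: cvg_sqr_drift_div].
rewrite mulr0 in H; apply: (cvg_near_eq _ H); near=> n.
have [_ ->] : 0 < d t n /\ d t n ^+ 2 = 2 * u n + 2 * drift t n + drift t n ^+ 2 / (2 * u n) :> R.
  by near: n; exact: d_near.
by rewrite invfM; ring.
Unshelve. all: by end_near. Qed.

End Asymptotics.

(** * Equivalents of the binomial tails *)

Lemma binom_pmf_sym (R : realType) n (p : R) k : (k <= n)%N ->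
  binom_pmf n p (n - k) = binom_pmf n (1 - p) k.
Proof.
by move=> kn; rewrite /binom_pmf bin_sub// subKn// subKr mulrAC.
Qed.

Lemma local_level_binom_tail (R : realType) (t : R) disp (T : measurableType disp)
    (P : probability T R) n (X : 'I_n -> {RV P >-> R}) i :
  iid_uniform01 X -> (1 <= i <= n)%N -> 0 < h i n (d t n) < 1 ->
  local_level X t i = binom_tail n (h i n (d t n)) i.
Proof.
move=> X_iid iN /andP[h0 h1]; rewrite /local_level prob_order_statistic_lt//.
by rewrite !ltW.
Qed.

Section Main.
Variable R : realType.
Implicit Types n : nat.

Lemma tail_equiv_of_pmf (alpha pmf g dl : nat -> R) (rho : R) :
  alpha n / pmf n @[n --> \oo] --> (1 - rho)^-1 -> rho < 1 ->
  dl @ \oo --> rho ->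
  (\forall n \near \oo, pmf n != 0) -> (\forall n \near \oo, g n != 0) ->
  pmf n / g n @[n --> \oo] --> (1 : R) ->
  alpha n / ((1 - dl n)^-1 * g n) @[n --> \oo] --> (1 : R).
Proof.
move=> H1 rho1 Hd p0 g0 H2.
have H : alpha n / pmf n * (1 - dl n) * (pmf n / g n) @[n --> \oo] --> (1 - rho)^-1 * (1 - rho) * 1.
  by apply: cvgM => //; apply: cvgM => //; apply: cvgB => //; exact: cvg_cst.
rewrite mulVf ?subr_eq0 ?gt_eqF// mulr1 in H.
apply: (cvg_near_eq _ H); near=> n.
have dn : 1 - dl n != 0.
  by rewrite subr_eq0 gt_eqF//; near: n; exact: (cvgr_lt _ Hd).
have pn : pmf n != 0 by near: n.
have gn : g n != 0 by near: n.
by field; rewrite pn gn dn.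
Unshelve. all: by end_near. Qed.

Section Parts.
Variables (t : R) (i : nat -> nat).
Let p n : R := h (i n) n (d t n).

Lemma near_boundary_root : (\forall n \near \oo, 0 < i n < n)%N ->
  \forall n \near \oo, boundary_root (d t n ^+ 2) n%:R (i n)%:R (p n) /\
    n%:R * p n < (i n)%:R.
Proof.
move=> i_in; near=> n.
have [d0 _] : 0 < d t n /\ d t n ^+ 2 = 2 * u n + 2 * drift t n + drift t n ^+ 2 / (2 * u n) :> R.
  by near: n; exact: d_near.
by apply: h_root => //; near: n.
Unshelve. all: by end_near. Qed.

(** The success probability p is small; the relative mean is below 1, so the
    branch is [delta], and successive ratios tend to delta (1/c). *)
Lemma small_rank_tail_equiv (c : R) : 0 < c -> (i n)%:R / u n @[n --> \oo] --> c ->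
  let v n := delta (u n / (i n)%:R) in
  binom_tail n (p n) (i n) / ((1 - v n)^-1 * ((Num.sqrt (2 * pi * (i n)%:R))^-1 *
    expR ((i n)%:R * rate (v n) - drift t n * (2 * v n / (1 + v n)))))
  @[n --> \oo] --> (1 : R).
Proof.
move=> c0 iu v.
have [iy niy i_in i_n0] := cvg_rank (@cvgry_u R) (@cvg_sqr_u_div R) c0 iu.
have root := near_boundary_root i_in.
have i0 : \forall n \near \oo, 0 < (i n)%:R :> R.
  by apply: filterS i_in => n /andP[+ _]; rewrite ltr0n.
have n0 : \forall n \near \oo, 0 < n%:R :> R.
  by near=> n; rewrite ltr0n; near: n; exact: nbhs_infty_gt.
have rho01 : 0 < delta c^-1 < 1 by apply: delta_itv; rewrite invr_gt0.
have := @boundary_pmf_equiv R u (fun n => d t n ^+ 2) (drift t) i p c delta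
  (@cvgry_u R) (@cvg_sqr_u_div R) (cvg_sqr_drift_div t) (cvg_d_sqr t) c0 iu.
case.
- by apply: nearW => n; exact: sqr_ge0.
- by apply: filterS root => n [].
- by move=> x x0; split; [case/andP: (delta_itv x0)|exact: rel_gap_delta].
- exact: continuous_delta.
- by case/andP: rho01 => _ /lt_eqF ->.
- near=> n.
  have inn : 0 < (i n)%:R :> R by near: n.
  have nn : 0 < n%:R :> R by near: n.
  have [[/andP[pn0 _] _] pin] : boundary_root (d t n ^+ 2) n%:R (i n)%:R (p n) /\
    n%:R * p n < (i n)%:R by near: n.
  have w0 : 0 < n%:R * p n / (i n)%:R by rewrite divr_gt0// mulr_gt0.
  by apply: delta_rel_gap; rewrite w0 ltr_pdivrMr// mul1r.
move=> p0 Hw Hv Hpmf.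
apply: (tail_equiv_of_pmf (pmf := fun n => binom_pmf n (p n) (i n)) (rho := delta c^-1)) => //.
- apply: binom_tail_equiv => //.
  + by apply: filterS root => n [[]].
  + by apply: filterS i_in => n /andP[].
  + have iV := @cvg_natV R _ iy.
    have H : n%:R * p n / (i n)%:R * (1 - (i n)%:R / n%:R) / ((1 + (i n)%:R^-1) * (1 - p n))
       @[n --> \oo] --> delta c^-1 * (1 - 0) / ((1 + 0) * (1 - 0)).
      apply: cvgM.
        by apply: cvgM => //; apply: cvgB => //; exact: cvg_cst.
      apply: cvgV; first by rewrite subr0 addr0 mulr1 oner_eq0.
      by apply: cvgM; [apply: cvgD|apply: cvgB] => //; exact: cvg_cst.
    rewrite subr0 addr0 !mulr1 divr1 in H.
    apply: (cvg_near_eq _ H); near=> n.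
    have [[/andP[pn0 pn1] _] _] : boundary_root (d t n ^+ 2) n%:R (i n)%:R (p n) /\
      n%:R * p n < (i n)%:R by near: n.
    have inn : 0 < (i n)%:R :> R by near: n.
    have nn : 0 < n%:R :> R by near: n.
    have /andP[_ iltn] : (0 < i n < n)%N by near: n.
    rewrite /binom_ratio natrB ?(ltnW iltn)// -natr1; field.
    by rewrite !gt_eqF//; lra.
  + by case/andP: rho01.
- by case/andP: rho01.
- near=> n; rewrite gt_eqF// binom_pmf_gt0//.
    by have [[]] : boundary_root (d t n ^+ 2) n%:R (i n)%:R (p n) /\
      n%:R * p n < (i n)%:R by near: n.
  by apply: ltnW; have /andP[_ ] : (0 < i n < n)%N by near: n.
- near=> n; rewrite gt_eqF// mulr_gt0 ?expR_gt0// invr_gt0 sqrtr_gt0.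
  by rewrite !mulr_gt0 ?pi_gt0//; near: n.
Unshelve. all: by end_near. Qed.

(** Exchanging success and failure, the weight at rank i for p is the weight at
    the small rank m = n - i for q = 1 - p, now with relative mean above 1: the
    branch is the inverse of [delta], and the tail ratios tend again to
    delta (1/c). *)
Lemma large_rank_tail_equiv (c : R) : (forall n, (0 < n)%N -> (1 <= i n <= n)%N) ->
  0 < c -> (n%:R - (i n)%:R) / u n @[n --> \oo] --> c ->
  let m n := (n - i n)%N in
  let v n := (delta (u n / (m n)%:R))^-1 in
  (\forall n \near \oo, (0 < m n)%N) /\
  binom_tail n (p n) (i n) / ((1 - (v n)^-1)^-1 * ((Num.sqrt (2 * pi * (m n)%:R))^-1 *
    expR ((m n)%:R * rate (v n) - drift t n * (2 * v n / (1 + v n)))))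
  @[n --> \oo] --> (1 : R).
Proof.
move=> i_range c0 iu m v.
have i_le : \forall n \near \oo, (1 <= i n <= n)%N.
  by near=> n; apply: i_range; near: n; exact: nbhs_infty_gt.
have mE : \forall n \near \oo, (m n)%:R = n%:R - (i n)%:R :> R.
  by apply: filterS i_le => n /andP[_ iN]; rewrite natrB.
have mu : (m n)%:R / u n @[n --> \oo] --> c.
  by apply: (cvg_near_eq _ iu); apply: filterS mE => n ->.
have [my nmy m_in m_n0] := cvg_rank (@cvgry_u R) (@cvg_sqr_u_div R) c0 mu.
have i_in : \forall n \near \oo, (0 < i n < n)%N.
  near=> n; have /andP[m0 _] : (0 < m n < n)%N by near: n.
  have /andP[-> _] : (1 <= i n <= n)%N by near: n.
  by rewrite -subn_gt0.
have iE : \forall n \near \oo, (n - m n)%N = i n.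
  by apply: filterS i_in => n /andP[_ /ltnW iN]; rewrite subKn.
have root := near_boundary_root i_in.
have m0 : \forall n \near \oo, 0 < (m n)%:R :> R.
  by apply: filterS m_in => n /andP[+ _]; rewrite ltr0n.
have n0 : \forall n \near \oo, 0 < n%:R :> R.
  by near=> n; rewrite ltr0n; near: n; exact: nbhs_infty_gt.
have rho01 : 0 < delta c^-1 < 1 by apply: delta_itv; rewrite invr_gt0.
pose q n := 1 - p n.
have qroot : \forall n \near \oo, boundary_root (d t n ^+ 2) n%:R (m n)%:R (q n) /\
    (m n)%:R < n%:R * q n.
  near=> n.
  have [rt pin] : boundary_root (d t n ^+ 2) n%:R (i n)%:R (p n) /\
    n%:R * p n < (i n)%:R by near: n.
  have -> : (m n)%:R = n%:R - (i n)%:R :> R by near: n.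
  split; first exact: boundary_root_compl.
  by rewrite mulrBr mulr1 ltrD2l ltrN2.
have := @boundary_pmf_equiv R u (fun n => d t n ^+ 2) (drift t) m q c (fun x => (delta x)^-1)
  (@cvgry_u R) (@cvg_sqr_u_div R) (cvg_sqr_drift_div t) (cvg_d_sqr t) c0 mu.
case.
- by apply: nearW => n; exact: sqr_ge0.
- by apply: filterS qroot => n [].
- move=> x x0; have /andP[d0 d1] := delta_itv x0.
  by rewrite invr_gt0 rel_gapV// rel_gap_delta.
- apply: cvgV; first by case/andP: rho01 => /lt0r_neq0.
  exact: continuous_delta.
- by rewrite invr_eq1; case/andP: rho01 => _ /lt_eqF ->.
- near=> n.
  have mm : 0 < (m n)%:R :> R by near: n.
  have nn : 0 < n%:R :> R by near: n.
  have [[/andP[qn0 _] _] qin] : boundary_root (d t n ^+ 2) n%:R (m n)%:R (q n) /\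
    (m n)%:R < n%:R * q n by near: n.
  have w0 : 0 < n%:R * q n / (m n)%:R by rewrite divr_gt0// mulr_gt0.
  rewrite -rel_gapV// delta_rel_gap ?invrK//.
  by rewrite invr_gt0 w0/= invf_lt1// ltr_pdivlMr// mul1r.
move=> q0 Hw Hv Hpmf.
split; first by apply: filterS m_in => n /andP[].
apply: (tail_equiv_of_pmf (pmf := fun n => binom_pmf n (p n) (i n)) (rho := delta c^-1)) => //.
- apply: binom_tail_equiv => //.
  + by apply: filterS root => n [[]].
  + by apply: filterS i_in => n /andP[].
  + apply/cvgnyPge => A; near=> n.
    have <- : (n - m n)%N = i n by near: n.
    by near: n; move/cvgnyPge : nmy; exact.
  + have H : (n%:R * q n / (m n)%:R)^-1 * (1 - q n) / (1 - (m n)%:R / n%:R + n%:R^-1)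
       @[n --> \oo] --> (delta c^-1)^-1^-1 * (1 - 0) / (1 - 0 + 0).
      apply: cvgM.
        apply: cvgM; last by apply: cvgB => //; exact: cvg_cst.
        by apply: cvgV => //; rewrite invr_neq0//; case/andP: rho01 => /lt0r_neq0.
      apply: cvgV; first by rewrite subr0 addr0 oner_eq0.
      apply: cvgD; first by apply: cvgB => //; exact: cvg_cst.
      by apply: (@cvg_natV R id); exact: cvg_id.
    rewrite invrK subr0 addr0 !mulr1 divr1 in H.
    apply: (cvg_near_eq _ H); near=> n.
    have [[/andP[pn0 pn1] _] _] : boundary_root (d t n ^+ 2) n%:R (i n)%:R (p n) /\
      n%:R * p n < (i n)%:R by near: n.
    have mn0 : 0 < (m n)%:R :> R by near: n.
    have nn : 0 < n%:R :> R by near: n.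
    have mnE : (m n)%:R = n%:R - (i n)%:R :> R by near: n.
    have iER : (i n)%:R = n%:R - (m n)%:R :> R by rewrite mnE; ring.
    have i0 : 0 <= (i n)%:R :> R by [].
    rewrite /binom_ratio -/(m n) -natr1 iER /q; field.
    by rewrite !gt_eqF//; lra.
  + by case/andP: rho01.
- by case/andP: rho01.
- rewrite -[X in _ --> X]invrK; apply: cvgV => //.
  by rewrite invr_neq0//; case/andP: rho01 => /lt0r_neq0.
- near=> n; rewrite gt_eqF// binom_pmf_gt0//.
    by have [[]] : boundary_root (d t n ^+ 2) n%:R (i n)%:R (p n) /\
      n%:R * p n < (i n)%:R by near: n.
  by apply: ltnW; have /andP[_ ] : (0 < i n < n)%N by near: n.
- near=> n; rewrite gt_eqF// mulr_gt0 ?expR_gt0// invr_gt0 sqrtr_gt0.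
  by rewrite !mulr_gt0 ?pi_gt0//; near: n.
- apply: (cvg_near_eq _ Hpmf); near=> n.
  have {1}<- : (n - m n)%N = i n by near: n.
  have /andP[_ /ltnW mn] : (0 < m n < n)%N by near: n.
  by rewrite binom_pmf_sym.
Unshelve. all: by end_near. Qed.
End Parts.
End Main.


(** * The explicit formulas *)

Lemma powRE (R : realType) (x r : R) : 0 < x -> x `^ r = expR (r * ln x).
Proof. by move=> x0; rewrite /powR gt_eqF. Qed.

(** In terms of v = delta c, the exponent (1 - v) / sqrt(c^2 + 2c) is
    2v / (1 + v), and the first power is exp (k rate v). *)
Lemma small_rank_form (R : realType) (U k b B : R) :
  0 < U -> 0 < k -> 0 < B -> ln B = - b ->
  let c := U / k in let v := delta c in
  (1 - v)^-1 * ((Num.sqrt (2 * pi * k))^-1 * expR (k * rate v - b * (2 * v / (1 + v)))) =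
  Num.sqrt c / ((1 - delta c) * Num.sqrt (2 * pi * U))
       * (delta c * expR 1 / expR (delta c)) `^ (U / c)
       * B `^ ((1 - delta c) / Num.sqrt (c ^+ 2 + 2 * c)).
Proof.
move=> U0 k0 B0 lnB c v; rewrite -/v.
have c0 : 0 < c by rewrite divr_gt0.
have UE : U = c * k by rewrite /c divfK// gt_eqF.
clearbody c.
have /andP[v0 v1] : 0 < v < 1 by exact: delta_itv.
set s := Num.sqrt (c ^+ 2 + 2 * c).
have c2 : 0 < c ^+ 2 + 2 * c by rewrite addr_gt0 ?exprn_gt0 ?mulr_gt0.
have s0 : 0 < s by rewrite sqrtr_gt0.
have sE : s ^+ 2 = c ^+ 2 + 2 * c by rewrite sqr_sqrtr// ltW.
have vE : v = 1 + c - s by [].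
have -> : U / c = k by rewrite UE mulrC mulKf// gt_eqF.
have e1 := expR_gt0 (1 : R); have ev := expR_gt0 v.
rewrite !powRE ?divr_gt0 ?mulr_gt0//.
rewrite ln_div ?posrE ?mulr_gt0// lnM ?posrE// !expRK lnB.
rewrite -[ln v + 1 - v]/(rate v).
have -> : (1 - v) / s = 2 * v / (1 + v).
  have E : (1 - v) * (1 + v) = 2 * v * s by rewrite vE; ring: sE.
  have v10 : 1 + v != 0 by rewrite gt_eqF// addr_gt0.
  by apply/eqP; rewrite eqr_div ?E// gt_eqF.
rewrite -[RHS]mulrA -expRD mulrN [b * _]mulrC mulrA; congr (_ * expR _).
have pi0 := pi_gt0 R.
have -> : Num.sqrt (2 * pi * U) = Num.sqrt c * Num.sqrt (2 * pi * k).
  rewrite -sqrtrM; last exact: ltW.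
  by congr Num.sqrt; rewrite UE; ring.
have sc : 0 < Num.sqrt c by rewrite sqrtr_gt0.
have sk : 0 < Num.sqrt (2 * pi * k) by rewrite sqrtr_gt0 !mulr_gt0.
by field; rewrite !gt_eqF// subr_gt0.
Qed.

(** In terms of v = 1 / delta (1 / c) = (1 + c + sqrt(1 + 2c)) / c, the geometric
    series factor v / (v - 1) and the exponents 2v / (1 + v) and m (1 - v) become
    the explicit functions of sqrt(1 + 2c) below; L stands for log n. *)
Lemma large_rank_form (R : realType) (U m b B L : R) :
  0 < U -> 0 < m -> 0 < B -> ln B = - b -> 0 < L -> ln L = U ->
  let c := m / U in let v := (delta (U / m))^-1 in
  (1 - v^-1)^-1 * ((Num.sqrt (2 * pi * m))^-1 * expR (m * rate v - b * (2 * v / (1 + v)))) =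
       (1 + c / (1 + Num.sqrt (1 + 2 * c)))
       * (1 / Num.sqrt (2 * pi * c * U))
       * ((1 + c + Num.sqrt (1 + 2 * c)) / c) `^ (c * U)
       * B `^ (1 + 1 / Num.sqrt (1 + 2 * c))
       * L `^ (- (1 + Num.sqrt (1 + 2 * c))).
Proof.
move=> U0 m0 B0 lnB L0 lnL c v.
have c0 : 0 < c by rewrite divr_gt0.
have cUE : c * U = m by rewrite /c divfK// gt_eqF.
have UmE : U / m = c^-1 by rewrite /c invf_div.
rewrite {}UmE in v *; clearbody c.
set s := Num.sqrt (1 + 2 * c).
have s1 : 1 < s by rewrite -[ltLHS]sqrtr1 ltr_sqrt; lra.
have s0 : 0 < s by lra.
have sE : s ^+ 2 = 1 + 2 * c by rewrite sqr_sqrtr// addr_ge0// mulr_ge0// ltW.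
have cE : c = (s ^+ 2 - 1) / 2 by rewrite sE; field.
have s21 : 0 < s ^+ 2 - 1 by rewrite sE; lra.
have vE : v = (1 + c + s) / c.
  have vp : 0 < (1 + c + s) / c by rewrite divr_gt0// !addr_gt0.
  suff H : delta c^-1 = ((1 + c + s) / c)^-1 by rewrite /v H invrK.
  rewrite -[RHS]delta_rel_gap; last first.
    by rewrite invr_gt0 vp/= invf_lt1// ltr_pdivlMr//; lra.
  congr delta; rewrite rel_gapV// /rel_gap cE; field.
  by rewrite !gt_eqF//; lra.
have v0 : 0 < v by rewrite vE divr_gt0// !addr_gt0.
rewrite -vE !powRE// lnB lnL.
rewrite -[RHS]mulrA -[RHS]mulrA -!expRD.
rewrite -(mulrA (2 * pi)) cUE div1r mulrA; congr (_ * _ * expR _).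
  rewrite vE cE; field.
  by rewrite !gt_eqF//; lra.
have -> : 2 * v / (1 + v) = 1 + 1 / s.
  rewrite vE cE; field.
  by rewrite !gt_eqF//; lra.
have -> : m * rate v = m * ln v - (1 + s) * U.
  rewrite /rate -cUE; move: (ln v) => l; rewrite vE; field.
  by rewrite gt_eqF.
by ring.
Qed.

Lemma eq_1o1_near (R : realType) (a g b : nat -> R) :
  (\forall n \near \oo, b n = g n /\ g n != 0) ->
  a n / g n @[n --> \oo] --> (1 : R) -> eq_1o1 a b.
Proof.
move=> bg H; exists (fun n => a n / g n - 1).
  by rewrite -[X in _ --> X](subrr 1); apply: cvgB => //; exact: cvg_cst.
by apply: filterS bg => n [-> gn]; rewrite addrC subrK mulrC divfK.
Qed.

Theorem lemma4p5 (R : realType) (t : R)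
    (disp : nat -> measure_display)
    (T : forall n : nat, measurableType (disp n))
    (P : forall n : nat, probability (T n) R)
    (U : forall n : nat, 'I_n -> {RV (P n) >-> R})
    (U_iid : forall n : nat, iid_uniform01 (U n))
    (i : nat -> nat)
    (i_range : forall n : nat, (0 < n)%N -> (1 <= i n <= n)%N) :
  let alpha := fun n : nat => local_level (U n) t (i n) in
  (forall c : R, 0 < c ->
     (fun n : nat => (i n)%:R / u n : R) @ \oo --> c ->
     let cn := fun n : nat => u n / (i n)%:R in
     eq_1o1 alpha (fun n : nat =>
       Num.sqrt (cn n) / ((1 - delta (cn n)) * Num.sqrt (2 * pi * u n))
       * (delta (cn n) * expR 1 / expR (delta (cn n))) `^ (u n / cn n)
       * (Num.sqrt pi * expR (- t) / Num.sqrt (u n))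
           `^ ((1 - delta (cn n)) / Num.sqrt (cn n ^+ 2 + 2 * cn n))))
  /\
  (forall c : R, 0 < c ->
     (fun n : nat => (n%:R - (i n)%:R) / u n : R) @ \oo --> c ->
     let cn := fun n : nat => (n%:R - (i n)%:R) / u n in
     eq_1o1 alpha (fun n : nat =>
       (1 + cn n / (1 + Num.sqrt (1 + 2 * cn n)))
       * (1 / Num.sqrt (2 * pi * cn n * u n))
       * ((1 + cn n + Num.sqrt (1 + 2 * cn n)) / cn n) `^ (cn n * u n)
       * (Num.sqrt pi * expR (- t) / Num.sqrt (u n))
           `^ (1 + 1 / Num.sqrt (1 + 2 * cn n))
       * (ln n%:R) `^ (- (1 + Num.sqrt (1 + 2 * cn n))))).
Proof.
move=> alpha.
have n_gt0 : \forall n \near \oo, (0 < n)%N by exact: nbhs_infty_gt.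
have u0 : \forall n \near \oo, 0 < @u R n by move/cvgryPgt : (@cvgry_u R); exact.
have lnB n : 0 < @u R n -> 0 < Num.sqrt pi * expR (- t) / Num.sqrt (u n) /\
    ln (Num.sqrt pi * expR (- t) / Num.sqrt (u n)) = - drift t n :> R.
  move=> un.
  have sp : 0 < Num.sqrt (pi : R) by rewrite sqrtr_gt0 pi_gt0.
  have su : 0 < Num.sqrt (u n : R) by rewrite sqrtr_gt0.
  have e0 := expR_gt0 (- t).
  split; first by rewrite divr_gt0 ?mulr_gt0.
  rewrite ln_div ?posrE ?mulr_gt0// lnM ?posrE// expRK.
  rewrite -!powR12_sqrt ?ln_powR ?pi_ge0 ?(ltW un)// /drift; ring.
split=> c c0 iu cn.
- have [_ _ i_in _] := cvg_rank (@cvgry_u R) (@cvg_sqr_u_div R) c0 iu.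
  have root := near_boundary_root t i_in.
  pose v n : R := delta (u n / (i n)%:R).
  pose g n : R := (1 - v n)^-1 * ((Num.sqrt (2 * pi * (i n)%:R))^-1 *
    expR ((i n)%:R * rate (v n) - drift t n * (2 * v n / (1 + v n)))).
  apply: (@eq_1o1_near _ _ g).
  + near=> n.
    have un : 0 < u n :> R by near: n.
    have [Bpos lnBE] := lnB n un.
    have k0 : 0 < (i n)%:R :> R.
      by rewrite ltr0n; have /andP[-> _] : (0 < i n < n)%N by near: n.
    rewrite -(small_rank_form un k0 Bpos lnBE) -/(v n); split => //.
    have /andP[_ v1] : 0 < v n < 1 by apply: delta_itv; rewrite divr_gt0.
    rewrite gt_eqF// !mulr_gt0 ?expR_gt0// invr_gt0 ?subr_gt0//.
    by rewrite sqrtr_gt0 !mulr_gt0 ?pi_gt0.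
  + apply: (cvg_near_eq _ (small_rank_tail_equiv t c0 iu)); near=> n.
    have [[p01 _] _] : boundary_root (d t n ^+ 2) n%:R (i n)%:R (h (i n) n (d t n)) /\
      n%:R * h (i n) n (d t n) < (i n)%:R by near: n.
    rewrite /alpha (@local_level_binom_tail R t _ _ _ _ _ _ (U_iid n))//.
    by apply: i_range; near: n.
- have i_le : \forall n \near \oo, (1 <= i n <= n)%N.
    by near=> n; apply: i_range; near: n.
  have [m0 Hm] := large_rank_tail_equiv t i_range c0 iu.
  have i_in : \forall n \near \oo, (0 < i n < n)%N.
    near=> n; have m0n : (0 < n - i n)%N by near: n.
    have /andP[-> _] : (1 <= i n <= n)%N by near: n.
    by rewrite -subn_gt0.
  have root := near_boundary_root t i_in.
  pose v n : R := (delta (u n / (n - i n)%:R))^-1.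
  pose g n : R := (1 - (v n)^-1)^-1 * ((Num.sqrt (2 * pi * (n - i n)%:R))^-1 *
    expR ((n - i n)%:R * rate (v n) - drift t n * (2 * v n / (1 + v n)))).
  apply: (@eq_1o1_near _ _ g).
  + near=> n.
    have un : 0 < u n :> R by near: n.
    have [Bpos lnBE] := lnB n un.
    have k0 : 0 < (n - i n)%:R :> R by rewrite ltr0n; near: n.
    have mE : n%:R - (i n)%:R = (n - i n)%:R :> R.
      by rewrite natrB//; have /andP[_ +] : (1 <= i n <= n)%N by near: n.
    have lnn : expR (u n) = ln n%:R :> R by near: n; exact: expR_u_near.
    have L0 : 0 < ln n%:R :> R by rewrite -lnn expR_gt0.
    rewrite /cn mE -(large_rank_form un k0 Bpos lnBE L0 erefl) -/(v n); split => //.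
    have /andP[_ v1] : 0 < delta (u n / (n - i n)%:R : R) < 1.
      by apply: delta_itv; rewrite divr_gt0.
    rewrite gt_eqF// !mulr_gt0 ?expR_gt0// invr_gt0 ?invrK ?subr_gt0//.
    by rewrite sqrtr_gt0 !mulr_gt0 ?pi_gt0.
  + apply: (cvg_near_eq _ Hm); near=> n.
    have [[p01 _] _] : boundary_root (d t n ^+ 2) n%:R (i n)%:R (h (i n) n (d t n)) /\
      n%:R * h (i n) n (d t n) < (i n)%:R by near: n.
    rewrite /alpha (@local_level_binom_tail R t _ _ _ _ _ _ (U_iid n))//.
    by apply: i_range; near: n.
Unshelve. all: by end_near. Qed.
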